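(* In the setting described in the context (analytic setting, stochastic setting, and operators $P$, $G$, $LAP$), assume the following three conditions. (E1) $(S,D)$ is essentially selfadjoint on $H$ and there is a constant $\Lambda_m>0$ with $-(Sf,f)_H\ge \Lambda_m\|(I-P)f\|^2$ for all $f\in D$. (E2) The technical condition holds, i.e. $P(D)\subset \overline{D}^A$, $AP(D)\subset \overline{D}^A\cap\overline{D}^S\cap\overline{D}^L$ and $L=S-A$ on $AP(D)$; and there are constants $c_1,c_2\in[0,\infty)$ with $\|LAPf\|\le c_1\|Gf\|+c_2\|f\|$ for all $f\in D_P$. (E3) $(G,D_P)$ is essentially selfadjoint on $H_P$; there is a constant $\Lambda_M>0$ with $-(Gf,f)_H\ge \Lambda_M\|f-(f,1)_H\|^2$ for all $f\in D_P$; and $1\in H_P$, $1\in\overline{D_P}^G$ and $G1=0$. Then for every $f\in L^2(E,\mu)$ and every $t>0$, $$\left\|\frac1t\int_0^t f(X_s)\,ds-\mathbb{E}_\mu[f]\right\|_{L^2(\mathbb{P})}\le \sqrt2\left(\frac1t\,\kappa_1+\frac{1}{\sqrt t}\,\kappa_2\right)\left\|f(X_0)-\mathbb{E}_\mu[f]\right\|_{L^2(\mathbb{P})},$$ where $\mathbb{E}_\mu[f]=\int_E f\,d\mu$ and $$\kappa_1=\frac{\sqrt2}{\sqrt{\Lambda_M}},\qquad \kappa_2=\frac{c_1+1}{\sqrt{\Lambda_m}}+\frac{c_2}{\sqrt{\Lambda_m}\,\Lambda_M}+\sqrt{\frac{c_1}{\sqrt{\Lambda_M}}+\frac{c_2}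{\Lambda_M\sqrt{\Lambda_M}}}\,.$$
   Context: Analytic setting. $E$ is a separable metric space with Borel $\sigma$-algebra $\mathcal{B}(E)$, $\mu$ is a probability measure on $(E,\mathcal{B}(E))$ and $H=L^2(E,\mu)$ with scalar product $(\cdot,\cdot)_H$ and norm $\|\cdot\|_H=\|\cdot\|$ (real-valued functions). $D\subset H$ is a dense linear subspace which is an algebra. $(S,D)$ is a symmetric nonpositive definite linear operator on $H$ and $(A,D)$ is an antisymmetric linear operator on $H$; $L:=S-A$ and $\hat L:=S+A$ on $D$. The measure $\mu$ is invariant: $\int_E Lf\,d\mu=0=\int_E\hat Lf\,d\mu$ for all $f\in D$. The operators with domain $D$ are closable and their closures on $H$ are denoted $(L,\overline{D}^L)$, $(\hat L,\overline{D}^{\hat L})$, $(S,\overline{D}^S)$, $(A,\overline{D}^A)$. $P\colon H\to\mathcal{N}(S)$ is the orthogonal projection onto the kernel $\mathcal{N}(S)$ of $(S,\overline{D}^S)$. $1$ denotes the constant function. Stochastic setting. $C([0,\infty);E)$ is the space of continuous paths in $E$, $X_t$ is the evaluation of paths at time $t$, $\mathcal{F}^0_t=\sigma(X_s: 0\le s\le t)$. A probability law is a probability measure on $C([0,\infty);E)$ equipped with $\sigma(X_s:s\ge0)$. A law $\mathbb{P}$ has invariant measure $\mu$ if $\mathbb{P}\circ X_t^{-1}=\mu$ for all $t\ge0$. $\mathbb{P}_T$ is the image of $\mathbb{P}$ under restriction of paths to $C([0,T];E)$ and $\tau_T((\omega_s)_{s\in[0,T]})=(\omega_{T-s})_{s\in[0,T]}$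 is time reversal. For $f\in D$ put $\Gamma_L(f,f)=\frac12(L(f^2)-2fLf)$, $$M^{[f],L}_t=f(X_t)-f(X_0)-\int_0^tLf(X_s)\,ds,\qquad N^{[f],L}_t=\big(M^{[f],L}_t\big)^2-2\int_0^t\Gamma_L(f,f)(X_s)\,ds,\quad t\ge0,$$ and analogously with $\hat L$ in place of $L$. (Under a law with invariant measure $\mu$, for $g\in L^1(\mu)$ the variables $g(X_t)$ and $\int_0^tg(X_s)\,ds$ are a.s. independent of the $\mu$-version of $g$.) Assumed: $\mathbb{P}$ and $\hat{\mathbb{P}}$ are probability laws on $C([0,\infty);E)$ with invariant measure $\mu$ such that $\hat{\mathbb{P}}_T=\mathbb{P}_T\circ\tau_T^{-1}$ for all $T\ge0$, and for all $f\in D$, $N^{[f],L}$ is an $(\mathcal{F}^0_t)_{t\ge0}$-martingale under $\mathbb{P}$ and $N^{[f],\hat L}$ is an $(\mathcal{F}^0_t)_{t\ge0}$-martingale under $\hat{\mathbb{P}}$. Further operators (under the technical condition). $D_P:=P(D)$; $H_P:=P(H)$ is a Hilbert space with the scalar product of $H$. $G\colon D_P\to H_P$ is $G:=PA^2P$ (i.e. $Gf=PA^2Pg$ for $f=Pg$, $g\in D$), and $(G,\overline{D_P}^G)$ is its closure on $H_P$. $LAP\colon D_P\to H$ is given by $LAPf=LAPg$ for $f=Pg$, $g\in D$. *)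

(* Defs.v *)
From HB Require Import structures.
From mathcomp Require Import all_boot all_order all_algebra.
From mathcomp Require Import all_classical all_reals all_analysis.
From mathcomp Require Import measurable_realfun.

Set Implicit Arguments.
Unset Strict Implicit.
Unset Printing Implicit Defensive.

Import Order.TTheory GRing.Theory Num.Theory.
Import numFieldNormedType.Exports.

Local Open Scope classical_set_scope.
Local Open Scope ring_scope.

(* MathComp-Analysis. The library type [LspaceType2 mu] of classes of functions
   in L^2(mu) carries no algebraic structure; we equip it here with the
   real vector space structure given by the pointwise operations. *)
Section L2.
Context d (T : measurableType d) (R : realType).
Variable mu : {measure set T -> \bar R}.

Local Notation H := (LspaceType2 mu).
Local Notation L2fun := (Lfun mu 2%:E).
Lemma Lfun2_ae (f g : T -> R) : measurable_fun [set: T] g ->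
  f = g %[ae mu] -> f \in L2fun -> g \in L2fun.
Proof.
move=> mg fg /andP[/[!inE]/= mf Ff]; apply/andP; split; first by rewrite inE.
rewrite inE/= /finite_norm; rewrite /finite_norm in Ff.
have mabs (h : T -> R) : measurable_fun [set: T] h ->
    measurable_fun [set: T] ((fun x => `|(EFin \o h) x| `^ 2)%E : T -> \bar R).
  move=> mh; apply: (@measurableT_comp _ _ _ _ _ _ (fun y : \bar R => y `^ 2)%E _ (abse \o (EFin \o h))).
    exact: measurable_poweR.
  by apply: measurableT_comp => //; exact/measurable_EFinP.
suff -> : ('N[mu]_2%:E[EFin \o g] = 'N[mu]_2%:E[EFin \o f])%E by [].
rewrite unlock /=; congr (_ `^ _)%E; apply: ae_eq_integral => //.
- exact: mabs.
- exact: mabs.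
- by apply: filterS fg => x /= /[apply] ->.
Qed.

Lemma L2_eqP (f g : H) : (f : T -> R) = g %[ae mu] -> f = g.
Proof.
case: f g => f [[nf]] [g [[ng]]] /= fg.
have e : f = g.
  by rewrite -[f]reprK -[g]reprK; apply/eqmodP/asboolP.
case: _ / e in ng fg *.
by rewrite (Prop_irrelevance nf ng).
Qed.

Section mk.
Variables (f : T -> R) (fL2 : f \in L2fun).

Let f_mfun_mixin :=
  @isMeasurableFun.Build _ _ T (measurableTypeR R) f
       (set_mem (sub_Lfun_mfun fL2)).
Let f_mfun : {mfun T >-> measurableTypeR R} :=
  HB.pack_for {mfun T >-> measurableTypeR R} f f_mfun_mixin.

Let f_class : {mfun_ mu, T >-> measurableTypeR R} := (\pi_({mfun_ mu, T >-> measurableTypeR R}) f_mfun)%qT.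

Let f_class_ae : f = f_class %[ae mu].
Proof.
have : f_mfun = repr f_class %[mod {mfun_ mu, T >-> measurableTypeR R}]%qT.
  by rewrite reprK.
by move/eqmodP/asboolP.
Qed.

Let f_class_fin : finite_norm mu (2%:R)%:E f_class.
Proof.
have : (f_class : T -> R) \in L2fun.
  apply: Lfun2_ae f_class_ae fL2.
  exact: (@measurable_funPT _ _ _ (measurableTypeR R) (repr f_class)).
by move=> /andP[_]; rewrite inE.
Qed.

HB.instance Definition _ :=
  @isFinLebesgue.Build _ T R mu _ (lee1n 2) f_class f_class_fin.

Definition L2mk : H := f_class.

Lemma L2mkE : f = L2mk %[ae mu].
Proof. exact: f_class_ae. Qed.
End mk.

Lemma L2_Lfun (f : H) : (f : T -> R) \in L2fun.
Proof.
apply/andP; split; rewrite inE /=.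
  exact: (@measurable_funPT _ _ _ (measurableTypeR R) (repr (LebesgueSpace.sort f))).
by case: f => f [[]].
Qed.


Lemma Lfun2_lin a (f g : T -> R) : f \in L2fun -> g \in L2fun ->
  (fun x => a * f x + g x) \in L2fun.
Proof. exact: (Lfun_submod_closed mu (lee1n 2)).2. Qed.

Lemma Lfun2_0 : (fun=> 0) \in L2fun.
Proof. exact: (Lfun_submod_closed mu (lee1n 2)).1. Qed.

(* The class of a function in L^2(mu); it is 0 if [f] is not in L^2(mu). *)
Definition L2class (f : T -> R) : H :=
  if pselect (f \in L2fun) is left fL2 then L2mk fL2 else L2mk Lfun2_0.

Lemma L2classE f : f \in L2fun -> f = L2class f %[ae mu].
Proof.
by rewrite /L2class; case: pselect => // fL2 _; exact: L2mkE.
Qed.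

Definition L2zero : H := L2class (fun=> 0).
Definition L2opp (f : H) : H := L2class (fun x => - f x).
Definition L2add (f g : H) : H := L2class (fun x => f x + g x).
Definition L2scale (a : R) (f : H) : H := L2class (fun x => a * f x).

Lemma L2zero_ae  : (L2zero : T -> R) = (fun=> 0) %[ae mu].
Proof. by apply: ae_eq_sym; apply/L2classE/Lfun2_0. Qed.

Lemma L2scale_ae a f : (L2scale a f : T -> R) = (fun x => a * f x) %[ae mu].
Proof.
apply: ae_eq_sym; apply/L2classE.
have := Lfun2_lin a (L2_Lfun f) Lfun2_0.
by under eq_fun do rewrite addr0.
Qed.

Lemma L2opp_ae f : (L2opp f : T -> R) = (fun x => - f x) %[ae mu].
Proof.
apply: ae_eq_sym; apply/L2classE.
have := Lfun2_lin (-1) (L2_Lfun f) Lfun2_0.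
by under eq_fun do rewrite addr0 mulN1r.
Qed.

Lemma L2add_ae f g : (L2add f g : T -> R) = (fun x => f x + g x) %[ae mu].
Proof.
apply: ae_eq_sym; apply/L2classE.
have := Lfun2_lin 1 (L2_Lfun f) (L2_Lfun g).
by under eq_fun do rewrite mul1r.
Qed.

Let addA : associative L2add.
Proof.
move=> f g h; apply: L2_eqP.
have h1 := L2add_ae f (L2add g h); have h2 := L2add_ae g h.
have h3 := L2add_ae (L2add f g) h; have h4 := L2add_ae f g.
apply: filterS2 (filterI h1 h2) (filterI h3 h4) =>
  x [{}h1 {}h2] [{}h3 {}h4] _.
by rewrite h1// h2// h3// h4// addrA.
Qed.

Let addC : commutative L2add.
Proof.
move=> f g; apply: L2_eqP.
by apply: filterS2 (L2add_ae f g) (L2add_ae g f) => x h1 h2 _;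
  rewrite h1// h2// addrC.
Qed.

Let add0 : left_id L2zero L2add.
Proof.
move=> f; apply: L2_eqP.
by apply: filterS2 (L2add_ae L2zero f) L2zero_ae => x h1 h2 _;
  rewrite h1// h2// add0r.
Qed.

Let addN : left_inverse L2zero L2opp L2add.
Proof.
move=> f; apply: L2_eqP.
apply: filterS3 (L2add_ae (L2opp f) f) L2zero_ae (L2opp_ae f) => x h1 h2 h3 _.
by rewrite h1// h2// h3// addNr.
Qed.

HB.instance Definition _ := gen_eqMixin H.
HB.instance Definition _ := gen_choiceMixin H.
HB.instance Definition _ := GRing.isZmodule.Build H addA addC add0 addN.

Let scaleA a b f : L2scale a (L2scale b f) = L2scale (a * b) f.
Proof.
apply: L2_eqP.
apply: filterS3 (L2scale_ae a (L2scale b f)) (L2scale_ae b f)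
  (L2scale_ae (a * b) f) => x h1 h2 h3 _.
by rewrite h1// h2// h3// mulrA.
Qed.

Let scale1 : left_id 1 L2scale.
Proof.
move=> f; apply: L2_eqP.
by apply: filterS (L2scale_ae 1 f) => x h1 _; rewrite h1// mul1r.
Qed.

Let scaleDr : right_distributive L2scale +%R.
Proof.
move=> a f g; apply: L2_eqP.
have h1 := L2scale_ae a (f + g); have h2 := L2add_ae f g.
have h3 := L2add_ae (L2scale a f) (L2scale a g).
have h4 := L2scale_ae a f; have h5 := L2scale_ae a g.
apply: filterS3 (filterI h1 h2) h3 (filterI h4 h5) =>
  x [{}h1 {}h2] {}h3 [{}h4 {}h5] _.
by rewrite h1// [in LHS]h2// [RHS]h3// h4// h5// mulrDr.
Qed.

Let scaleDl f : {morph L2scale^~ f : a b / a + b}.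
Proof.
move=> a b; apply: L2_eqP.
have h1 := L2scale_ae (a + b) f.
have h2 := L2add_ae (L2scale a f) (L2scale b f).
have h3 := L2scale_ae a f; have h4 := L2scale_ae b f.
apply: filterS2 (filterI h1 h2) (filterI h3 h4) =>
  x [{}h1 {}h2] [{}h3 {}h4] _.
by rewrite h1// [RHS]h2// h3// h4// mulrDl.
Qed.

HB.instance Definition _ :=
  GRing.Zmodule_isLmodule.Build R H scaleA scale1 scaleDr scaleDl.

End L2.

Definition L2dot d (T : measurableType d) (R : realType)
    (mu : {measure set T -> \bar R}) (f g : LspaceType2 mu) : R :=
  \int[mu]_x (f x * g x).

(* Unbounded operators on a real inner product space [(V, dot)]. An operator
   with domain [D] is a function [V -> V] of which only the values on [D] are
   meaningful. [K] is the ambient (closed) subspace in which closures and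
   adjoints are taken: [setT], or the range of a projection. *)
Section operators.
Context (R : realType) (V : lmodType R).
Variable dot : V -> V -> R.
Implicit Types (D K N : set V) (S T P : V -> V) (Gr : set (V * V)).

Definition hnorm (f : V) : R := Num.sqrt (dot f f).

Definition linear_on D S :=
  forall a f g, D f -> D g -> S (a *: f + g) = a *: S f + S g.

Definition symmetric_on D S :=
  forall f g, D f -> D g -> dot (S f) g = dot f (S g).

Definition antisymmetric_on D S :=
  forall f g, D f -> D g -> dot (S f) g = - dot f (S g).

Definition dense_in K D :=
  D `<=` K /\
  forall f, K f -> forall e, 0 < e -> exists2 g, D g & hnorm (f - g) < e.

Definition opgraph D S : set (V * V) := [set (f, S f) | f in D].

Definition closure_graph K Gr : set (V * V) :=
  [set p | [/\ K p.1, K p.2 & forall e, 0 < e ->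
     exists2 q, Gr q & hnorm (p.1 - q.1) < e /\ hnorm (p.2 - q.2) < e]].

Definition adjoint_graph K Gr : set (V * V) :=
  [set p | [/\ K p.1, K p.2 & forall q, Gr q -> dot q.2 p.1 = dot q.1 p.2]].

Definition closable K D S :=
  forall g, closure_graph K (opgraph D S) (0, g) -> g = 0.

Definition closure_dom K D S : set V :=
  [set f | exists g, closure_graph K (opgraph D S) (f, g)].

Definition closure_op K D S (f : V) : V :=
  xget 0 [set g | closure_graph K (opgraph D S) (f, g)].

Definition ess_selfadjoint K D S :=
  let Sbar := closure_graph K (opgraph D S) in
  [/\ dense_in K D, closable K D S & Sbar = adjoint_graph K Sbar].

Definition closure_ker K D S : set V :=
  [set f | closure_dom K D S f /\ closure_op K D S f = 0].

Definition orth_proj N P :=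
  forall f, N (P f) /\ forall g, N g -> dot (f - P f) g = 0.

End operators.

(* Metric spaces with a distinguished point, as [measurableType] is pointed;
   this only excludes the empty space, which carries no probability measure. *)
#[short(type="pmetricType")]
HB.structure Definition PointedMetric (R : numDomainType) :=
  {E of Metric R E & Pointed E}.

Definition separable (X : topologicalType) :=
  exists2 A : set X, countable A & dense A.

Definition borel (X : ptopologicalType) := g_sigma_algebraType (@open X).

(* The space C(I; E) of continuous paths. *)
Section path_space.
Context (R : realType) (I : set R) (E : pmetricType R).

Definition cpath : Type := continuousType I E.
HB.instance Definition _ := Choice.on cpath.
HB.instance Definition _ := isPointed.Build cpath (cst (point : E)).

(* The sets {X_s \in B}, for s in J and B a Borel set. *)
Definition cylinders (J : set I) : set (set cpath) :=
  \bigcup_(s in J) preimage_set_system [set: cpath] (fun w : cpath => w s)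
    (@measurable _ (borel E)).

Definition path_space := g_sigma_algebraType (cylinders setT).
End path_space.

Section restriction_reversal.
Context (R : realType) (E : pmetricType R).

Definition infinite_horizon : set R := `[0, +oo[%classic.
Definition finite_horizon (T : R) : set R := `[0, T]%classic.

Lemma extend_time_subproof T (s : finite_horizon T) :
  set_val s \in infinite_horizon.
Proof.
have := set_valP s; rewrite inE /infinite_horizon /finite_horizon /= !in_itv/=.
by rewrite andbT => /andP[].
Qed.

Definition extend_time T (s : finite_horizon T) : infinite_horizon :=
  exist _ (set_val s) (extend_time_subproof s).

Lemma reverse_time_subproof T (s : finite_horizon T) :
  T - set_val s \in finite_horizon T.
Proof.
have := set_valP s; rewrite inE /finite_horizon /= !in_itv/= => /andP[s0 sT].
by rewrite subr_ge0 sT/= gerBl.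
Qed.

Definition reverse_time T (s : finite_horizon T) : finite_horizon T :=
  exist _ (T - set_val s) (reverse_time_subproof s).

Lemma extend_time_continuous T : continuous (@extend_time T).
Proof. by apply: continuous_comp_initial; exact: initial_continuous. Qed.

Lemma reverse_time_continuous T : continuous (@reverse_time T).
Proof.
apply: continuous_comp_initial => s.
by apply: (@continuousB R R^o (finite_horizon T));
  [exact: cst_continuous | exact: initial_continuous].
Qed.

Definition path_restrict (T : R) (w : path_space infinite_horizon E) :
    path_space (finite_horizon T) E :=
  (w : continuousType _ _) \o mkcts (@extend_time_continuous T).

Definition path_reverse (T : R) (w : path_space (finite_horizon T) E) :
    path_space (finite_horizon T) E :=
  (w : continuousType _ _) \o mkcts (@reverse_time_continuous T).

End restriction_reversal.

Arguments infinite_horizon : clear implicits.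

Notation paths E := (path_space (infinite_horizon _) E).

(* Evaluation at time [t >= 0]; for [t < 0] the value is the irrelevant
   default [point] of [valL]. *)
Definition X (R : realType) (E : pmetricType R) (t : R) (w : paths E) : E :=
  valL (w : infinite_horizon R -> E) t.

(* The uncompleted sigma-algebra generated by the X_s, 0 <= s <= t. *)
Definition natural_filtration (R : realType) (E : pmetricType R) (t : R) :
    set (set (paths E)) :=
  <<s @cylinders R _ E [set s : infinite_horizon R | set_val s <= t] >>.

Section martingale.
Context d (T : measurableType d) (R : realType).
Variable P : probability T R.

(* [Z] is a version of the conditional expectation of [Y] given [G]. *)
Definition is_cond_exp (G : set (set T)) (Y Z : T -> R) :=
  [/\ preimage_set_system setT Z (@measurable _ (measurableTypeR R)) `<=` G,
      P.-integrable setT (EFin \o Z) &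
      forall A, G A -> (\int[P]_(w in A) (Z w)%:E = \int[P]_(w in A) (Y w)%:E)%E].

Definition martingale (F : R -> set (set T)) (N : R -> T -> R) :=
  (forall t, 0 <= t ->
    preimage_set_system setT (N t) (@measurable _ (measurableTypeR R)) `<=` F t
    /\ P.-integrable setT (EFin \o N t)) /\
  (forall s t, 0 <= s -> s <= t -> is_cond_exp (F s) (N t) (N s)).

End martingale.

Section processes.
Context (R : realType) (E : pmetricType R).
Variable mu : probability (borel E) R.
Local Notation H := (LspaceType2 mu).
Implicit Types (L : H -> H) (f : H) (t : R) (w : paths E).

(* A class [f : H] is coerced to one of its Borel versions. Where a path
   integral does not converge [Rintegral] is 0; under a law with invariant
   measure [mu] this happens on a null set only. *)
Definition Gamma L f (x : E) : R :=
  2^-1 * (L (L2class mu (fun y => f y * f y)) x - 2 * f x * L f x).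

Definition Mproc L f t w : R :=
  f (X t w) - f (X 0 w) - \int[lebesgue_measure]_(s in `[0, t]) L f (X s w).

Definition Nproc L f t w : R :=
  Mproc L f t w ^+ 2 - 2 * \int[lebesgue_measure]_(s in `[0, t]) Gamma L f (X s w).

End processes.

Section settings.
Context (R : realType) (E : pmetricType R) (mu : probability (borel E) R).
Local Notation H := (LspaceType2 mu).
Local Notation dot := (@L2dot _ _ R mu).
Variables (D : set H) (S A P : H -> H).

Definition L2one : H := L2class mu (fun=> 1).

Definition opL : H -> H := fun f => S f - A f.
Definition opLhat : H -> H := fun f => S f + A f.

(* [D] is an algebra for the pointwise product, which in particular has to stay
   in L^2(mu) on [D]. *)
Record analytic_setting : Prop := {
  D_subspace : submod_closed (mem D) ;
  D_dense : dense_in dot setT D ;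
  D_algebra : forall f g : H, D f -> D g ->
    (fun x => f x * g x) \in Lfun mu 2%:E /\
    D (L2class mu (fun x => f x * g x)) ;
  S_linear : linear_on D S ;
  S_symmetric : symmetric_on dot D S ;
  S_nonpositive : forall f, D f -> dot (S f) f <= 0 ;
  A_linear : linear_on D A ;
  A_antisymmetric : antisymmetric_on dot D A ;
  L_invariant : forall f, D f -> \int[mu]_x opL f x = 0 ;
  Lhat_invariant : forall f, D f -> \int[mu]_x opLhat f x = 0 ;
  L_closable : closable dot setT D opL ;
  Lhat_closable : closable dot setT D opLhat ;
  S_closable : closable dot setT D S ;
  A_closable : closable dot setT D A ;
  P_projection : orth_proj dot (closure_ker dot setT D S) P
}.

Definition invariant_law (Q : probability (paths E) R) :=
  forall t, 0 <= t -> forall B, measurable B ->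
    pushforward Q (@X R E t : _ -> borel E) B = mu B.

Definition time_reversal (Q Qhat : probability (paths E) R) :=
  forall T, 0 <= T -> forall B, measurable B ->
    pushforward Qhat (@path_restrict R E T) B =
    pushforward (pushforward Q (@path_restrict R E T)) (@path_reverse R E T) B.

Record stochastic_setting (Q Qhat : probability (paths E) R) : Prop := {
  Q_invariant : invariant_law Q ;
  Qhat_invariant : invariant_law Qhat ;
  Qhat_reversal : time_reversal Q Qhat ;
  Q_martingale : forall f, D f ->
    martingale Q (@natural_filtration R E) (Nproc opL f) ;
  Qhat_martingale : forall f, D f ->
    martingale Qhat (@natural_filtration R E) (Nproc opLhat f)
}.

Local Notation Sbar := (closure_op dot setT D S).
Local Notation Abar := (closure_op dot setT D A).
Local Notation Lbar := (closure_op dot setT D opL).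
Local Notation domS := (closure_dom dot setT D S).
Local Notation domA := (closure_dom dot setT D A).
Local Notation domL := (closure_dom dot setT D opL).

Definition H_P : set H := range P.
Definition D_P : set H := P @` D.

Definition technical_condition :=
  [/\ D_P `<=` domA,
      Abar @` D_P `<=` domA `&` domS `&` domL &
      forall g, (Abar @` D_P) g -> Lbar g = Sbar g - Abar g].

(* [P] is idempotent: on [D_P] one has [P f = f], so that [opG (P g) = P A^2 P g] and
   [opLAP (P g) = L A P g]. *)
Definition opG (f : H) : H := P (Abar (Abar (P f))).
Definition opLAP (f : H) : H := Lbar (Abar (P f)).

Definition condition_E1 (Lm : R) :=
  ess_selfadjoint dot setT D S /\
  forall f, D f -> Lm * hnorm dot (f - P f) ^+ 2 <= - dot (S f) f.

Definition condition_E2 (c1 c2 : R) :=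
  technical_condition /\
  forall f, D_P f ->
    hnorm dot (opLAP f) <= c1 * hnorm dot (opG f) + c2 * hnorm dot f.

Definition condition_E3 (LM : R) :=
  [/\ ess_selfadjoint dot H_P D_P opG,
      forall f, D_P f ->
        LM * hnorm dot (f - dot f L2one *: L2one) ^+ 2 <= - dot (opG f) f,
      H_P L2one,
      closure_dom dot H_P D_P opG L2one &
      closure_op dot H_P D_P opG L2one = 0].

End settings.

Definition kappa1 (R : realType) (LM : R) : R := Num.sqrt 2 / Num.sqrt LM.

Definition kappa2 (R : realType) (Lm LM c1 c2 : R) : R :=
  (c1 + 1) / Num.sqrt Lm + c2 / (Num.sqrt Lm * LM)
  + Num.sqrt (c1 / Num.sqrt LM + c2 / (LM * Num.sqrt LM)).

(* Main.v *)
(* Along the paths, the forward martingale of [f] under the law [Q] and the backward one,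
   read under the time-reversed law, both have squared L^2-norm [-2 t (S f, f)]. Their sum
   cancels the boundary terms and bounds the time integral of [S f] by
   [sqrt (-2 t (S f, f))]; the forward one alone bounds the time integral of [L f], with an
   additional boundary term [2 |f|]. Now split [f], of mean zero, into [(I - P) f + P f].
   Since [S] is essentially selfadjoint, its range is dense in the orthogonal complement
   of its kernel, so that the first term is an approximate [S g], and the spectral gap gives
   [-(S g, g) <= |S g|^2 / Lm]. Likewise the second term is an approximate [G h], and
   [G h = - L A h + (I - P) L A h] reduces it to the two previous estimates, where
   [|A h|^2 = - (G h, h) <= |G h|^2 / LM]. *)

Require Import Defs.
From HB Require Import structures.
From mathcomp Require Import all_boot all_order all_algebra.
From mathcomp Require Import all_classical all_reals all_analysis.
From mathcomp Require Import measurable_realfun.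
From mathcomp Require Import ring lra.

Set Implicit Arguments.
Unset Strict Implicit.
Unset Printing Implicit Defensive.

Import Order.TTheory GRing.Theory Num.Theory.
Import numFieldNormedType.Exports.

Local Open Scope classical_set_scope.
Local Open Scope ring_scope.

(** * Abstract inner product spaces *)

(** The functional analysis is done for an abstract scalar product and a functional [N] that stands
    for the [L^2(Q)] norm of the time integral; the bound [N f <= t * nm f] lets estimates known on
    [D] pass to closures. One approximation is delicate: [one] lies only in the domain of the
    closure of [G], so a preimage [h] under [G] cannot be centered by subtracting a constant. An
    almost constant element of [D_P] is subtracted instead, and the mean of [h] only tends to 0. The
    constants arise as follows, with G h close to P f. The boundary term 2 |A h| <= 2 |G h| / sqrt
    LM gives sqrt 2 kappa1. With |L A h| <= (c1 + c2 / LM) |G h|, the energy term sqrt (2 t |L A h|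
    |A h|) gives the nested root in kappa2, and sqrt (2 t / Lm) |L A h| gives (c1 + c2 / LM) / sqrt
    Lm. The part (I - P) f adds the last 1 / sqrt Lm. On the path side, Tonelli's theorem requires
    measurability jointly in time and path, while the sigma-algebra of the path space only provides
    fixed times; continuity of the paths bridges this gap. *)

Record inner_product (R : realType) (V : lmodType R) (dot : V -> V -> R) : Prop := {
  dotC : forall f g, dot f g = dot g f ;
  dot_linearl : forall a f g h, dot (a *: f + g) h = a * dot f h + dot g h ;
  dot_ge0 : forall f, 0 <= dot f f ;
  dot_eq0 : forall f, dot f f = 0 -> f = 0
}.

Definition hcvg (R : realType) (V : lmodType R) (dot : V -> V -> R)
    (u : nat -> V) (l : V) :=
  hnorm dot (u n - l) @[n --> \oo] --> (0 : R).

(* Equivalent to completeness, as every Cauchy sequence has a subsequence with such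
   increments. *)
Definition hcomplete (R : realType) (V : lmodType R) (dot : V -> V -> R) :=
  forall u : nat -> V,
    (forall n, hnorm dot (u n.+1 - u n) <= 2^-1 ^+ n) -> exists l, hcvg dot u l.

Section inner_product_theory.
Context (R : realType) (V : lmodType R) (dot : V -> V -> R).
Context (ip : inner_product dot).
Local Notation nm := (hnorm dot).
Implicit Types (f g h : V) (a b e : R).

Lemma dotDl f g h : dot (f + g) h = dot f h + dot g h.
Proof. by have := dot_linearl ip 1 f g h; rewrite scale1r mul1r. Qed.

Lemma dot0l h : dot 0 h = 0.
Proof.
by have := dotDl 0 0 h; rewrite addr0 => /eqP; rewrite -subr_eq0 opprD addNKr oppr_eq0 => /eqP.
Qed.

Lemma dotZl a f h : dot (a *: f) h = a * dot f h.
Proof. by have := dot_linearl ip a f 0 h; rewrite addr0 dot0l addr0. Qed.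

Lemma dotNl f h : dot (- f) h = - dot f h.
Proof. by rewrite -scaleN1r dotZl mulN1r. Qed.

Lemma dotBl f g h : dot (f - g) h = dot f h - dot g h.
Proof. by rewrite dotDl dotNl. Qed.

Lemma dot0r h : dot h 0 = 0.
Proof. by rewrite (dotC ip) dot0l. Qed.

Lemma dotDr f g h : dot h (f + g) = dot h f + dot h g.
Proof. by rewrite !(dotC ip h) dotDl. Qed.

Lemma dotZr a f h : dot h (a *: f) = a * dot h f.
Proof. by rewrite !(dotC ip h) dotZl. Qed.

Lemma dotNr f h : dot h (- f) = - dot h f.
Proof. by rewrite !(dotC ip h) dotNl. Qed.

Lemma dotBr f g h : dot h (f - g) = dot h f - dot h g.
Proof. by rewrite dotDr dotNr. Qed.

Definition dotE := (dotDl, dotDr, dotNl, dotNr, dotZl, dotZr, dot0l, dot0r).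

Lemma hnorm_ge0 f : 0 <= nm f.
Proof. exact: sqrtr_ge0. Qed.

Lemma sqr_hnorm f : nm f ^+ 2 = dot f f.
Proof. by rewrite sqr_sqrtr ?(dot_ge0 ip). Qed.

Lemma hnorm_eq0 f : nm f = 0 -> f = 0.
Proof. by move=> f0; apply: (dot_eq0 ip); rewrite -sqr_hnorm f0 expr0n. Qed.

Lemma hnorm0 : nm 0 = 0.
Proof. by rewrite /hnorm dot0l sqrtr0. Qed.

Lemma hnormZ a f : nm (a *: f) = `|a| * nm f.
Proof.
by rewrite /hnorm !dotE mulrA -expr2 sqrtrM ?sqr_ge0// sqrtr_sqr.
Qed.

Lemma hnormN f : nm (- f) = nm f.
Proof. by rewrite -scaleN1r hnormZ normrN1 mul1r. Qed.

Lemma hnormC f g : nm (f - g) = nm (g - f).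
Proof. by rewrite -opprB hnormN. Qed.

(** Cauchy-Schwarz: expand the square of [nm g *: f - nm f *: g] and divide by [2 * nm f * nm g]. *)
Lemma dot_le_hnorm f g : dot f g <= nm f * nm g.
Proof.
have [/hnorm_eq0 ->|f0] := eqVneq (nm f) 0; first by rewrite dot0l hnorm0 mul0r.
have [/hnorm_eq0 ->|g0] := eqVneq (nm g) 0; first by rewrite dot0r hnorm0 mulr0.
have fgt0 : 0 < nm f by rewrite lt_def f0 hnorm_ge0.
have ggt0 : 0 < nm g by rewrite lt_def g0 hnorm_ge0.
have := dot_ge0 ip (nm g *: f - nm f *: g).
rewrite !dotE (dotC ip g f) -!sqr_hnorm => H.
have : 0 <= 2 * (nm f * nm g) * (nm f * nm g - dot f g) by nra.
by rewrite pmulr_rge0 ?subr_ge0// !mulr_gt0.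
Qed.

Lemma normr_dot_le f g : `|dot f g| <= nm f * nm g.
Proof.
by rewrite ler_norml dot_le_hnorm andbT lerNl -dotNl -(hnormN f) dot_le_hnorm.
Qed.

Lemma ler_hnormD f g : nm (f + g) <= nm f + nm g.
Proof.
rewrite -[leRHS]ger0_norm ?addr_ge0 ?hnorm_ge0// -sqrtr_sqr.
rewrite ler_sqrt ?sqr_ge0// sqrrD !sqr_hnorm !dotE (dotC ip g f).
have := dot_le_hnorm f g; lra.
Qed.

Lemma ler_hnormB f g : nm (f - g) <= nm f + nm g.
Proof. by rewrite -(hnormN g) ler_hnormD. Qed.

Lemma ler_hdistD h f g : nm (f - g) <= nm (f - h) + nm (h - g).
Proof. by rewrite -(subrKA h f (- g)) ler_hnormD. Qed.

Lemma ler_hnormlD f g : `|nm f - nm g| <= nm (f - g).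
Proof.
rewrite ler_norml; have := ler_hnormD (f - g) g; have := ler_hnormD (g - f) f.
by rewrite !subrK (hnormC g f) => *; apply/andP; split; lra.
Qed.

Lemma hcvgP (u : nat -> V) l :
  hcvg dot u l <-> forall e, 0 < e -> \forall n \near \oo, nm (u n - l) < e.
Proof.
split=> [/cvgrPdist_lt ul e e0|ul].
  have := ul _ e0; apply: filterS => n.
  by rewrite sub0r normrN ger0_norm ?hnorm_ge0.
apply/cvgrPdist_lt => e e0; have := ul _ e0; apply: filterS => n.
by rewrite sub0r normrN ger0_norm ?hnorm_ge0.
Qed.

Lemma hcvg_le (u : nat -> V) l (c : nat -> R) :
  (forall n, nm (u n - l) <= c n) -> c n @[n --> \oo] --> (0 : R) -> hcvg dot u l.
Proof.
move=> uc c0; apply: squeeze_cvgr c0; last exact: cvg_cst.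
by near=> n; rewrite hnorm_ge0 uc.
Unshelve. all: by end_near. Qed.

Lemma hcvg_cst l : hcvg dot (fun=> l) l.
Proof. by rewrite /hcvg subrr hnorm0; exact: cvg_cst. Qed.

Lemma hcvg_linear a (u v : nat -> V) l m : hcvg dot u l -> hcvg dot v m ->
  hcvg dot (fun n => a *: u n + v n) (a *: l + m).
Proof.
move=> ul vm; apply: (@hcvg_le _ _ (fun n => `|a| * nm (u n - l) + nm (v n - m))).
  move=> n; rewrite opprD addrACA -scalerBr (le_trans (ler_hnormD _ _))//.
  by rewrite hnormZ.
rewrite -[0]addr0; apply: cvgD => //.
by rewrite -[X in _ --> X](mulr0 `|a|); apply: cvgM => //; exact: cvg_cst.
Qed.

Lemma hcvgN (u : nat -> V) l : hcvg dot u l -> hcvg dot (fun n => - u n) (- l).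
Proof.
by rewrite /hcvg => ul; under eq_fun do rewrite -opprB hnormN opprK addrC.
Qed.

Lemma hcvgD (u v : nat -> V) l m : hcvg dot u l -> hcvg dot v m ->
  hcvg dot (fun n => u n + v n) (l + m).
Proof.
move=> ul vm; have := hcvg_linear 1 ul vm.
by rewrite scale1r; under [X in hcvg _ X]eq_fun do rewrite scale1r.
Qed.

Lemma hcvgB (u v : nat -> V) l m : hcvg dot u l -> hcvg dot v m ->
  hcvg dot (fun n => u n - v n) (l - m).
Proof. by move=> ul /hcvgN; exact: hcvgD. Qed.

Lemma cvg_hnorm (u : nat -> V) l : hcvg dot u l -> nm (u n) @[n --> \oo] --> nm l.
Proof.
move=> /hcvgP ul; apply/cvgrPdist_lt => e /ul; apply: filterS => n.
by apply: le_lt_trans; rewrite hnormC ler_hnormlD.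
Qed.

(* Polarization reduces the continuity of the scalar product to that of the norm. *)
Lemma cvg_dot (u v : nat -> V) l m : hcvg dot u l -> hcvg dot v m ->
  dot (u n) (v n) @[n --> \oo] --> dot l m.
Proof.
move=> ul vm.
have E f g : dot f g = 4^-1 * (nm (f + g) * nm (f + g) - nm (f - g) * nm (f - g)).
  by rewrite -!expr2 !sqr_hnorm !dotE (dotC ip g f); field.
rewrite E; under eq_fun do rewrite E.
have cD := cvg_hnorm (hcvgD ul vm); have cB := cvg_hnorm (hcvgB ul vm).
by apply: cvgM; [exact: cvg_cst|apply: cvgB; apply: cvgM].
Qed.

Lemma cvg_eq (u v : nat -> R) a b :
  u n @[n --> \oo] --> a -> v n @[n --> \oo] --> b -> (forall n, u n = v n) -> a = b.
Proof.
move=> ua vb /funext uv; rewrite uv in ua.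
exact: (cvg_unique _ ua vb).
Qed.

Lemma cvg_ler (u v : nat -> R) a b :
  u n @[n --> \oo] --> a -> v n @[n --> \oo] --> b -> (forall n, u n <= v n) -> a <= b.
Proof.
move=> ua vb uv; rewrite -(cvg_lim _ ua)// -(cvg_lim _ vb)//.
apply: ler_lim; [by apply/cvg_ex; exists a|by apply/cvg_ex; exists b|].
by near=> n.
Unshelve. all: by end_near. Qed.

Lemma cvg_dot_eq0 (u : nat -> V) l h :
  hcvg dot u l -> (forall n, dot (u n) h = 0) -> dot l h = 0.
Proof.
by move=> ul uh; exact: (cvg_eq (cvg_dot ul (hcvg_cst h)) (cvg_cst _)).
Qed.

Lemma invS_cvg0 : (n.+1%:R : R)^-1 @[n --> \oo] --> (0 : R).
Proof. exact: cvg_harmonic. Qed.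

Lemma exists_hcvg (W : set V) f :
  (forall e, 0 < e -> exists2 w, W w & nm (f - w) < e) ->
  exists2 u : nat -> V, (forall n, W (u n)) & hcvg dot u f.
Proof.
move=> Wf.
have /choice[u Hu] : forall n : nat, exists w, W w /\ nm (f - w) < n.+1%:R^-1.
  by move=> n; have [|w Ww fw] := Wf (n.+1%:R^-1); [rewrite invr_gt0|exists w].
exists u; first by move=> n; case: (Hu n).
by apply: hcvg_le invS_cvg0 => n; rewrite hnormC ltW//; case: (Hu n).
Qed.

(** Choosing approximants at distance 1 / (n + 1) turns the closure into a statement on sequences,
    the form in which all closures are used below. *)
Lemma closure_graphP (K D : set V) (S : V -> V) f g :
  closure_graph dot K (opgraph D S) (f, g) <->
  [/\ K f, K g & exists u : nat -> V,
    [/\ forall n, D (u n), hcvg dot u f & hcvg dot (fun n => S (u n)) g]].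
Proof.
split=> [[/= Kf Kg fg]|[Kf Kg [u [Du uf ug]]]].
  split => //.
  have /choice[u Hu] : forall n : nat, exists w,
      [/\ D w, nm (f - w) < n.+1%:R^-1 & nm (g - S w) < n.+1%:R^-1].
    move=> n; have [|_ [w Dw <-] [/= fw gw]] := fg (n.+1%:R^-1); first by rewrite invr_gt0.
    by exists w.
  exists u; split; first by move=> n; case: (Hu n).
  - by apply: hcvg_le invS_cvg0 => n; rewrite hnormC ltW//; case: (Hu n).
  - by apply: hcvg_le invS_cvg0 => n; rewrite hnormC ltW//; case: (Hu n).
split => //= e e0.
have [n [un Sun]] : exists n, nm (u n - f) < e /\ nm (S (u n) - g) < e.
  have /hcvgP/(_ _ e0) h1 := uf; have /hcvgP/(_ _ e0) h2 := ug.
  have [n _ H] : \forall n \near \oo, nm (u n - f) < e /\ nm (S (u n) - g) < e.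
    by apply: filterS2 h1 h2.
  by exists n; apply: H => /=.
exists (u n, S (u n)); first by exists (u n).
by rewrite /= hnormC un hnormC.
Qed.

(** * Orthogonal projection onto the closure of a subspace *)

Section orthogonal_decomposition.
Context (W : set V) (Vcomplete : hcomplete dot).
Context (W0 : W 0) (Wlin : forall a f g, W f -> W g -> W (a *: f + g)).

(** The classical minimizing sequence for the distance from [f] to [W]. As [W] need not be closed,
    [p] is only a limit of its elements. *)
Lemma orthogonal_decomposition f : exists p,
  (forall e, 0 < e -> exists2 w, W w & nm (p - w) < e) /\
  (forall w, W w -> dot (f - p) w = 0).
Proof.
pose A := [set nm (f - w) ^+ 2 | w in W]; pose d := inf A.
have infA : has_inf A.
  split; first by exists (nm (f - 0) ^+ 2); exists 0.
  by exists 0 => _ [w _ <-]; exact: sqr_ge0.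
have d_le w : W w -> d <= nm (f - w) ^+ 2.
  by move=> Ww; apply: ge_inf; [exact: infA.2|exists w].
(* With an excess of 4^-n / 8, the parallelogram identity bounds the squared n-th increment by 5/16
   of 4^-n, within the 4^-n that [hcomplete] admits. *)
have /choice[u Hu] : forall n, exists w, W w /\ nm (f - w) ^+ 2 < d + 8^-1 * (2^-1 ^+ n) ^+ 2.
  move=> n; have [|_ [w Ww <-] ?] := @inf_adherent _ A (8^-1 * (2^-1 ^+ n) ^+ 2) _ infA.
    by rewrite mulr_gt0// exprn_gt0// exprn_gt0.
  by exists w.
have midW n m : W (2^-1 *: (u n + u m)).
  rewrite -[_ *: _]addr0; apply: Wlin => //; rewrite -[u n]scale1r.
  by apply: Wlin; exact: (Hu _).1.
have parallelogram n m : nm (u n - u m) ^+ 2 =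
    2 * nm (f - u n) ^+ 2 + 2 * nm (f - u m) ^+ 2 - 4 * nm (f - 2^-1 *: (u n + u m)) ^+ 2.
  rewrite !sqr_hnorm !dotE (dotC ip (u m) (u n)) (dotC ip (u m) f) (dotC ip (u n) f).
  lra.
have [|p up] := Vcomplete (u := u).
  move=> n; rewrite -ler_sqr ?nnegrE ?hnorm_ge0 ?exprn_ge0//.
  rewrite parallelogram; have := (Hu n).2; have := (Hu n.+1).2; have := d_le _ (midW n.+1 n).
  rewrite [2^-1 ^+ n.+1]exprS exprMn; set x := (2^-1 ^+ n) ^+ 2; have x0 : 0 <= x by exact: sqr_ge0.
  lra.
have dp : nm (f - p) ^+ 2 <= d.
  have h2 : d + 8^-1 * (2^-1 ^+ n) ^+ 2 @[n --> \oo] --> d + 8^-1 * (0 * 0).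
    apply: cvgD; first exact: cvg_cst.
    apply: cvgM; first exact: cvg_cst.
    have c : (2^-1 : R) ^+ n @[n --> \oo] --> (0 : R).
      by apply: cvg_expr; rewrite ger0_norm//; lra.
    exact: cvgM.
  rewrite mulr0 mulr0 addr0 in h2.
  have c : nm (f - u n) @[n --> \oo] --> nm (f - p).
    by apply: cvg_hnorm; apply: hcvgB => //; exact: hcvg_cst.
  apply: (cvg_ler (cvgM c c) h2) => n /=.
  by apply: ltW; exact: (Hu n).2.
exists p; split.
  move=> e e0; have [n _ H] : \forall n \near \oo, nm (u n - p) < e by move/hcvgP: up; exact.
  by exists (u n); [exact: (Hu n).1|rewrite hnormC; apply: H => /=].
move=> w Ww.
(* [p] still minimizes the distance along the line through [p] in direction [w]. *)
have key a : 0 <= a ^+ 2 * dot w w - 2 * a * dot (f - p) w.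
  have c : nm (f - (a *: w + u n)) @[n --> \oo] --> nm (f - (a *: w + p)).
    apply: cvg_hnorm; apply: hcvgB; first exact: hcvg_cst.
    by apply: hcvg_linear => //; exact: hcvg_cst.
  have : d <= nm (f - (a *: w + p)) ^+ 2.
    apply: (cvg_ler (cvg_cst d) (cvgM c c)) => n /=.
    by apply: d_le; apply: Wlin => //; exact: (Hu n).1.
  move=> /(le_trans dp).
  rewrite !sqr_hnorm !dotE (dotC ip w p) (dotC ip w f) (dotC ip p f) => H; nra.
set c := dot (f - p) w in key *.
have [w0|w0] := eqVneq (dot w w) 0.
  by move: (key 1) (key (-1)); rewrite w0; lra.
have wgt0 : 0 < dot w w by rewrite lt_def w0 (dot_ge0 ip).
(* The value [a := c / dot w w] minimizes the quadratic polynomial in [key]. *)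
have : 0 <= - (c ^+ 2 / dot w w).
  apply: le_trans (key (c / dot w w)) _; rewrite le_eqVlt; apply/orP; left.
  by apply/eqP; field.
rewrite oppr_ge0 pmulr_lle0 ?invr_gt0// => c2.
by apply/eqP; rewrite -sqrf_eq0 eq_le c2 sqr_ge0.
Qed.

End orthogonal_decomposition.

(** * Closures of linear operators *)

Section closure.
Context (K D : set V) (S : V -> V).
Context (D0 : D 0) (Dlin : forall a f g, D f -> D g -> D (a *: f + g)).
Context (K0 : K 0) (Klin : forall a f g, K f -> K g -> K (a *: f + g)).
Context (Slin : linear_on D S).
Local Notation Gr := (closure_graph dot K (opgraph D S)).

Lemma linear_on0 : S 0 = 0.
Proof.
have := Slin 1 D0 D0; rewrite scaler0 scale1r addr0 => /eqP.
by rewrite -subr_eq0 opprD addNKr oppr_eq0 => /eqP.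
Qed.

Lemma closure_graph_linear a f f' g g' :
  Gr (f, f') -> Gr (g, g') -> Gr (a *: f + g, a *: f' + g').
Proof.
move=> /closure_graphP[Kf Kf' [u [Du uf Suf]]] /closure_graphP[Kg Kg' [v [Dv vg Svg]]].
apply/closure_graphP; split; [exact: Klin|exact: Klin|].
exists (fun n => a *: u n + v n); split=> [n||]; [exact: Dlin|exact: hcvg_linear|].
under [X in hcvg _ X]eq_fun do rewrite Slin//.
exact: hcvg_linear.
Qed.

Lemma closure_graphN f f' : Gr (f, f') -> Gr (- f, - f').
Proof.
have G0 : Gr (0, 0).
  apply/closure_graphP; split => //; exists (fun=> 0); split => //.
  - exact: hcvg_cst.
  - by rewrite linear_on0; exact: hcvg_cst.
by move=> /(closure_graph_linear (-1))/(_ G0); rewrite !addr0 !scaleN1r.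
Qed.

Lemma closure_graph_fun : closable dot K D S ->
  forall f g g', Gr (f, g) -> Gr (f, g') -> g = g'.
Proof.
move=> clos f g g' fg /closure_graphN fg'; apply/eqP; rewrite -subr_eq0; apply/eqP.
by apply: clos; have := closure_graph_linear 1 fg fg'; rewrite !scale1r subrr.
Qed.

Lemma closure_opP f : closure_dom dot K D S f -> Gr (f, closure_op dot K D S f).
Proof. by move=> fg; exact: (@xgetPex _ 0 [set g | Gr (f, g)]). Qed.

Lemma closure_opE : closable dot K D S ->
  forall f g, Gr (f, g) -> closure_op dot K D S f = g.
Proof.
by move=> clos f g fg; apply: (closure_graph_fun clos _ fg); apply: closure_opP; exists g.
Qed.

Lemma closure_graph_op f : D f -> K f -> K (S f) -> Gr (f, S f).
Proof.
move=> Df Kf KSf; apply/closure_graphP; split => //.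
by exists (fun=> f); split => //; exact: hcvg_cst.
Qed.

End closure.

Lemma closure_graph_closed (K D : set V) (S : V -> V) (u v : nat -> V) f g :
  K f -> K g -> (forall n, closure_graph dot K (opgraph D S) (u n, v n)) ->
  hcvg dot u f -> hcvg dot v g -> closure_graph dot K (opgraph D S) (f, g).
Proof.
move=> Kf Kg Guv uf vg; split => //= e e0.
have e20 : 0 < e / 2 by rewrite divr_gt0.
have [n [un vn]] : exists n, nm (u n - f) < e / 2 /\ nm (v n - g) < e / 2.
  have /hcvgP/(_ _ e20) h1 := uf; have /hcvgP/(_ _ e20) h2 := vg.
  have [n _ H] : \forall n \near \oo, nm (u n - f) < e / 2 /\ nm (v n - g) < e / 2.
    by apply: filterS2 h1 h2.
  by exists n; apply: H => /=.
have [_ _ /(_ _ e20)[q Sq [/= q1 q2]]] := Guv n.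
exists q => //; split.
- rewrite (le_lt_trans (ler_hdistD (u n) _ _))// (splitr e) ltrD//.
  by rewrite hnormC.
- rewrite (le_lt_trans (ler_hdistD (v n) _ _))// (splitr e) ltrD//.
  by rewrite hnormC.
Qed.

(** Orthogonality to the range says that the adjoint maps [k] to 0, and the adjoint is the closure
    itself. Hence the complement of the range is contained in the kernel of the closure; this is how
    essential selfadjointness yields dense ranges, for [S] as for [G]. *)
Lemma ess_selfadjoint_orthogonal_range (K D : set V) (S : V -> V) k :
  K 0 -> ess_selfadjoint dot K D S -> K k ->
  (forall f, D f -> dot (S f) k = 0) ->
  closure_graph dot K (opgraph D S) (k, 0).
Proof.
move=> K0 [_ _ ->] Kk Sk; split => //= -[f g] /closure_graphP[_ _ [u [Du _ ug]]] /=.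
by rewrite dot0r; apply: cvg_dot_eq0 ug _ => n; exact: Sk.
Qed.

End inner_product_theory.

(** * The Hilbert space L^2 *)

Section L2_theory.
Context d (T : measurableType d) (R : realType).
Variable mu : {measure set T -> \bar R}.
Local Notation H := (LspaceType2 mu).
Local Notation dot := (@L2dot _ _ R mu).
Local Notation nm := (hnorm dot).
Local Notation L2fun := (Lfun mu 2%:E).
Implicit Types (f g h : H) (phi psi : T -> R).

Lemma Lfun_measurable p phi : phi \in Lfun mu p -> measurable_fun setT phi.
Proof. by move=> /andP[/[!inE]]. Qed.

Lemma L2_measurable f : measurable_fun setT (f : T -> R).
Proof. exact: Lfun_measurable (L2_Lfun f). Qed.

Lemma Lfun2D phi psi : phi \in L2fun -> psi \in L2fun ->
  (fun x => phi x + psi x) \in L2fun.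
Proof.
by move=> h1 h2; have := Lfun2_lin 1 h1 h2; under eq_fun do rewrite mul1r.
Qed.

Lemma Lfun2N phi : phi \in L2fun -> (fun x => - phi x) \in L2fun.
Proof.
move=> h1; have := Lfun2_lin (-1) h1 (Lfun2_0 mu).
by under eq_fun do rewrite mulN1r addr0.
Qed.

Lemma Lfun2B phi psi : phi \in L2fun -> psi \in L2fun ->
  (fun x => phi x - psi x) \in L2fun.
Proof. by move=> h1 /Lfun2N; exact: Lfun2D. Qed.

Lemma L2DE f g : ((f + g : H) : T -> R) = (fun x => f x + g x) %[ae mu].
Proof. exact: L2add_ae. Qed.

Lemma L2ZE a f : ((a *: f : H) : T -> R) = (fun x => a * f x) %[ae mu].
Proof. exact: L2scale_ae. Qed.

Lemma L2NE f : ((- f : H) : T -> R) = (fun x => - f x) %[ae mu].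
Proof. exact: L2opp_ae. Qed.

Lemma eq_L2class phi psi : phi \in L2fun -> psi \in L2fun ->
  phi = psi %[ae mu] -> L2class mu phi = L2class mu psi.
Proof.
move=> h1 h2 e; apply: L2_eqP.
by apply: filterS3 (L2classE h1) (L2classE h2) e => x + + + _ => <-// <-// ->.
Qed.

Lemma L2classK f : L2class mu f = f.
Proof. by apply: L2_eqP; apply/ae_eq_sym/L2classE/L2_Lfun. Qed.

Lemma L2class_linear a phi psi : phi \in L2fun -> psi \in L2fun ->
  L2class mu (fun x => a * phi x + psi x) = a *: L2class mu phi + L2class mu psi.
Proof.
move=> h1 h2; apply: L2_eqP.
apply: filterS3 (L2classE (Lfun2_lin a h1 h2))
  (filterI (L2classE h1) (L2classE h2))
  (filterI (L2DE (a *: L2class mu phi) (L2class mu psi)) (L2ZE a (L2class mu phi))).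
by move=> x e1 [e2 e3] [e4 e5] _; rewrite -e1// e4// e5// -e2// -e3.
Qed.

Lemma L2classD phi psi : phi \in L2fun -> psi \in L2fun ->
  L2class mu (fun x => phi x + psi x) = L2class mu phi + L2class mu psi.
Proof.
move=> h1 h2; have := L2class_linear 1 h1 h2.
by under eq_fun do rewrite mul1r; rewrite scale1r.
Qed.

Lemma L2classN phi : phi \in L2fun -> L2class mu (fun x => - phi x) = - L2class mu phi.
Proof.
move=> h1; apply: L2_eqP.
apply: filterS3 (L2classE (Lfun2N h1)) (L2NE (L2class mu phi)) (L2classE h1).
by move=> x e1 e2 e3 _; rewrite -e1// e2// -e3.
Qed.

Lemma L2classB phi psi : phi \in L2fun -> psi \in L2fun ->
  L2class mu (fun x => phi x - psi x) = L2class mu phi - L2class mu psi.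
Proof. by move=> h1 h2; rewrite L2classD ?Lfun2N// L2classN. Qed.

Lemma Lfun2_integrableM phi psi : phi \in L2fun -> psi \in L2fun ->
  mu.-integrable setT (EFin \o (fun x => phi x * psi x)).
Proof. by move=> h1 h2; apply/Lfun1_integrable/Lfun2_mul_Lfun1. Qed.

Lemma Lfun2P phi : measurable_fun setT phi ->
  (\int[mu]_x (phi x ^+ 2)%:E < +oo)%E -> phi \in L2fun.
Proof.
move=> mphi phioo; apply/andP; split; rewrite inE//= /finite_norm unlock poweR_lty//.
rewrite (eq_integral (fun x => (phi x ^+ 2)%:E))// => x _ /=.
by rewrite powR_mulrn// real_normK ?num_real.
Qed.

Lemma ae_eq_Rintegral phi psi : measurable_fun setT phi -> measurable_fun setT psi ->
  phi = psi %[ae mu] -> \int[mu]_x phi x = \int[mu]_x psi x.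
Proof.
move=> m1 m2 e; congr fine; apply: ae_eq_integral => //.
- exact/measurable_EFinP.
- exact/measurable_EFinP.
- by apply: filterS e => x /[apply] ->.
Qed.

Lemma L2dot_class phi psi : phi \in L2fun -> psi \in L2fun ->
  dot (L2class mu phi) (L2class mu psi) = \int[mu]_x (phi x * psi x).
Proof.
move=> h1 h2; apply: ae_eq_Rintegral.
- by apply: measurable_funM; exact: L2_measurable.
- by apply: measurable_funM; [exact: Lfun_measurable h1|exact: Lfun_measurable h2].
- by apply: filterS2 (L2classE h1) (L2classE h2) => x e1 e2 _; rewrite -e1// -e2.
Qed.

Lemma L2dot_inner_product : inner_product dot.
Proof.
split.
- by move=> f g; congr fine; apply: eq_integral => x _; rewrite mulrC.
- move=> a f g h; rewrite /L2dot.
  have i1 := Lfun2_integrableM (L2_Lfun f) (L2_Lfun h).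
  have i2 := Lfun2_integrableM (L2_Lfun g) (L2_Lfun h).
  rewrite -RintegralZl// -RintegralD//; last first.
    by have := integrableZl measurableT a i1.
  apply: ae_eq_Rintegral.
  + by apply: measurable_funM; exact: L2_measurable.
  + apply: measurable_funD; last by apply: measurable_funM; exact: L2_measurable.
    apply: measurable_funM; first exact: measurable_cst.
    by apply: measurable_funM; exact: L2_measurable.
  + apply: filterS2 (L2DE (a *: f) g) (L2ZE a f) => x e1 e2 _.
    by rewrite e1// e2// mulrDl mulrA.
- by move=> f; apply: Rintegral_ge0 => x _; rewrite -expr2 sqr_ge0.
- move=> f f0; apply: L2_eqP.
  have if2 := Lfun2_integrableM (L2_Lfun f) (L2_Lfun f).
  have : (\int[mu]_x `|(f x * f x)%:E| = 0)%E.
    under eq_integral do rewrite gee0_abs ?lee_fin -?expr2 ?sqr_ge0//.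
    rewrite -[LHS]fineK; last exact: (integrable_fin_num _ if2).
    by rewrite [X in X%:E]f0.
  move=> /(ae_eq_integral_abs mu measurableT _).1 => /(_ _)[].
    by case/integrableP: if2.
  move=> N [mN N0 sub].
  have e : (f : T -> R) = (fun=> 0) %[ae mu].
    exists N; split=> // x /= /not_implyP[_ fx]; apply: sub => /= /(_ I)/eqP.
    by rewrite eqe mulf_eq0 orbb => /eqP.
  by apply: filterS2 e (L2zero_ae mu) => x + + _ => -> // ->.
Qed.

(** Bridge between the Hilbert norm of the estimates and the norm ['N[mu]_2] of the final
    statement. *)
Lemma hnorm_class phi : phi \in L2fun ->
  (nm (L2class mu phi))%:E = 'N[mu]_2%:E[EFin \o phi]%E.
Proof.
move=> h; rewrite /hnorm L2dot_class// unlock.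
have i2 := Lfun2_integrable_sqr h.
have -> : (\int[mu]_x `|(EFin \o phi) x| `^ 2)%E = (\int[mu]_x (phi x ^+ 2)%:E)%E.
  by apply: eq_integral => x _ /=; rewrite powR_mulrn// real_normK ?num_real.
have fin := integrable_fin_num measurableT i2.
have -> : \int[mu]_x (phi x * phi x) = \int[mu]_x (phi x ^+ 2).
  by apply: eq_Rintegral => x _; rewrite expr2.
rewrite -[in RHS](fineK fin) poweR_EFin powR12_sqrt// fine_ge0//.
by apply: integral_ge0 => x _; rewrite lee_fin sqr_ge0.
Qed.

(** In this extended-real form norms can be compared by Tonelli's theorem and by changes of
    variables for nonnegative integrands. *)
Lemma hnorm_class_sqr phi : phi \in L2fun ->
  ((nm (L2class mu phi) ^+ 2)%:E = \int[mu]_x (phi x ^+ 2)%:E)%E.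
Proof.
move=> h; rewrite (sqr_hnorm L2dot_inner_product) L2dot_class//.
have fin := integrable_fin_num measurableT (Lfun2_integrableM h h).
rewrite /Rintegral fineK//; apply: eq_integral => x _; rewrite expr2.
Qed.

End L2_theory.

Lemma half_series_le (R : realType) m n :
  \sum_(m <= k < m + n) 2^-1 ^+ k <= 2 * 2^-1 ^+ m :> R.
Proof.
rewrite geometric_partial_tail (le_trans (geometric_le_lim _ _ _ _))//.
- by rewrite ger0_norm//; lra.
- rewrite [1 - _](_ : _ = 2^-1); last by lra.
  by rewrite invrK mulrC.
Qed.

Lemma limn_einf_le (R : realType) (u : nat -> \bar R) (l : \bar R) :
  (forall n, u n <= l)%E -> (limn_einf u <= l)%E.
Proof.
move=> ul; rewrite limn_einf_lim; apply: lime_le; first exact: is_cvg_einfs.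
apply: nearW => n; apply: le_trans (ul n).
by apply: ereal_inf_lbound; exists n => /=.
Qed.

(** * Completeness of L^2 over a probability space *)

Section complete.
Context d (T : measurableType d) (R : realType).
Variable mu : probability T R.
Local Notation H := (LspaceType2 mu).
Local Notation dot := (@L2dot _ _ R mu).
Local Notation nm := (hnorm dot).
Local Notation L2fun := (Lfun mu 2%:E).
Local Notation ip := (L2dot_inner_product mu).

Lemma Lfun2_cst (c : R) : (fun=> c) \in L2fun.
Proof. exact: Lfun_cst. Qed.

Lemma hnorm_cst1 : nm (L2class mu (fun=> 1)) = 1.
Proof.
apply/eqP; rewrite -(eqrXn2 (_ : 0 < 2)%N)// ?hnorm_ge0//; apply/eqP/EFin_inj.
rewrite hnorm_class_sqr ?Lfun2_cst//.
by rewrite integral_cst//= probability_setT mule1 expr1n.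
Qed.

Lemma Lfun2_integrable (phi : T -> R) : phi \in L2fun ->
  mu.-integrable setT (EFin \o phi).
Proof.
move=> h; have := Lfun2_integrableM h (Lfun2_cst 1).
by under eq_fun do rewrite mulr1.
Qed.

(** Cauchy-Schwarz against the constant 1, whose norm is 1 under a probability. *)
Lemma L1_le_hnorm (phi : T -> R) : phi \in L2fun ->
  (\int[mu]_x `|phi x|%:E <= (nm (L2class mu phi))%:E)%E.
Proof.
move=> h.
have h' : (fun x => `|phi x|) \in L2fun.
  apply: Lfun2P; first by apply: measurableT_comp => //; exact: Lfun_measurable h.
  under eq_integral do rewrite real_normK ?num_real//.
  by rewrite -hnorm_class_sqr// ltry.
have := normr_dot_le ip (L2class mu (fun x => `|phi x|)) (L2class mu (fun=> 1)).
rewrite hnorm_cst1.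
have -> : nm (L2class mu (fun x => `|phi x|)) = nm (L2class mu phi).
  apply/eqP; rewrite -(eqrXn2 (_ : 0 < 2)%N)// ?hnorm_ge0//; apply/eqP/EFin_inj.
  by rewrite !hnorm_class_sqr//; apply: eq_integral => x _; rewrite real_normK ?num_real.
rewrite mulr1 L2dot_class ?Lfun2_cst//.
under eq_Rintegral do rewrite mulr1.
move=> /(le_trans (ler_norm _)); rewrite -lee_fin; apply: le_trans.
by rewrite fineK//; exact: (integrable_fin_num _ (Lfun2_integrable h')).
Qed.

(* Riesz-Fischer: as [mu] is finite, a sequence with summable L^2 increments has summable
   L^1 increments, hence converges almost everywhere. *)
Lemma L2_hcomplete : hcomplete dot.
Proof.
move=> u udist.
pose g n x := `|u n.+1 x - u n x|.
have g0 n x : 0 <= g n x by exact: normr_ge0.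
have ug n : (fun x => u n.+1 x - u n x) \in L2fun by apply: Lfun2B; exact: L2_Lfun.
have uE n m : L2class mu (fun x => u n x - u m x) = u n - u m.
  by rewrite L2classB ?L2_Lfun// !L2classK.
have mg n : measurable_fun setT (g n).
  by apply: measurableT_comp => //; exact: Lfun_measurable (ug n).
have intg : (\int[mu]_x (\sum_(n <oo) (g n x)%:E) <= 2%:E)%E.
  rewrite integral_nneseries//; last 2 first.
  - by move=> n; exact/measurable_EFinP.
  - by move=> n x _; rewrite lee_fin g0.
  apply: lime_le.
    by apply: is_cvg_nneseries => n _ _; apply: integral_ge0 => x _; rewrite lee_fin g0.
  apply: nearW => n; apply: (@le_trans _ _ (\sum_(0 <= k < n) (2^-1 ^+ k)%:E)%E).
    apply: lee_sum => k _; apply: (le_trans (L1_le_hnorm (ug k))).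
    by rewrite uE lee_fin udist.
  by rewrite sumEFin lee_fin; have := half_series_le R 0 n; rewrite expr0 mulr1.
have sg0 x : (0 <= \sum_(n <oo) (g n x)%:E)%E by apply: nneseries_ge0 => n _ _; rewrite lee_fin g0.
have ae_cvg : {ae mu, forall x, cvgn (fun n => u n x)}.
  have ig : mu.-integrable setT (fun x => \sum_(n <oo) (g n x)%:E)%E.
    apply/integrableP; split.
      by apply: ge0_emeasurable_sum => [k x _ _|k _]; [rewrite lee_fin g0|exact/measurable_EFinP].
    by under eq_integral do rewrite gee0_abs//; rewrite (le_lt_trans intg)// ltry.
  have := integrable_ae measurableT ig; apply: filterS => x /(_ I) fx.
  have cs : cvgn (series (fun n => u n.+1 x - u n x)).
    apply: normed_cvg; apply: nnseries_is_cvg => [k|]; first exact: normr_ge0.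
    by move: fx; rewrite ge0_fin_numE.
  have -> : (fun n => u n x) = (fun n => u 0%N x + series (fun n => u n.+1 x - u n x) n).
    by apply/funext => n; rewrite /series/= telescope_sumr// subrKC.
  by apply: is_cvgD => //; exact: is_cvg_cst.
(* An upper limit is defined at every point and measurable; it agrees with the limit almost
   everywhere. *)
pose l x := fine (limn_esup (fun n => (u n x)%:E)).
have ml : measurable_fun setT l.
  apply: measurableT_comp => //; apply: measurable_fun_limn_esup => n.
  by apply/measurable_EFinP; exact: L2_measurable.
have ae_l : {ae mu, forall x, u n x @[n --> \oo] --> l x}.
  apply: filterS ae_cvg => x /cvg_ex[a ua].
  suff -> : l x = a by [].
  have uE' : (fun n => (u n x)%:E) @ \oo --> a%:E by apply: cvg_EFin => //; exact: nearW.
  by rewrite /l (cvg_limn_einf_sup uE').2.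
have nm_u n m : nm (u (n + m)%N - u n) <= 2 * 2^-1 ^+ n.
  apply: le_trans (half_series_le R n m).
  rewrite -telescope_sumr ?leq_addr//.
  elim/big_ind2: _ => // [|a f b f' h1 h2]; first by rewrite hnorm0//; exact: ip.
  by rewrite (le_trans (ler_hnormD ip _ _))// lerD.
(* Fatou's lemma in [m] transfers the bound on [u (n + m) - u n] to [l - u n], which also shows that
   [l] is square integrable. *)
have dist n : (\int[mu]_x ((l x - u n x) ^+ 2)%:E <= ((2 * 2^-1 ^+ n) ^+ 2)%:E)%E.
  have mumn m : measurable_fun setT (fun x => ((u (n + m)%N x - u n x) ^+ 2)%:E).
    by apply/measurable_EFinP/measurable_funX/measurable_funB; exact: L2_measurable.
  have sq0 m x : [set: T] x -> (0 <= ((u (n + m)%N x - u n x) ^+ 2)%:E)%E.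
    by rewrite lee_fin sqr_ge0.
  have := fatou mu measurableT mumn sq0.
  have -> : (\int[mu]_x limn_einf (fun m => ((u (n + m)%N x - u n x) ^+ 2)%:E) =
    \int[mu]_x ((l x - u n x) ^+ 2)%:E)%E.
    apply: ae_eq_integral.
    - exact: measurableT.
    - apply: measurableT_comp => //; apply: measurable_fun_limn_esup => m.
      exact: measurableT_comp.
    - by apply/measurable_EFinP/measurable_funX/measurable_funB => //; exact: L2_measurable.
    - apply: filterS ae_l => x ux _.
      have c : u (n + m)%N x - u n x @[m --> \oo] --> l x - u n x.
        apply: cvgB; last exact: cvg_cst.
        by under eq_fun do rewrite addnC; move: ux; rewrite -(cvg_shiftn n).
      have c2 : (fun m => ((u (n + m)%N x - u n x) ^+ 2)%:E) @ \oo -->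
          ((l x - u n x) ^+ 2)%:E.
        by apply: cvg_EFin; [exact: nearW|exact: (cvgM c c)].
      by rewrite (cvg_limn_einf_sup c2).1.
  move/le_trans; apply; apply: limn_einf_le => m.
  rewrite -hnorm_class_sqr ?Lfun2B ?L2_Lfun// uE lee_fin.
  by rewrite ler_sqr ?nnegrE ?hnorm_ge0// mulr_ge0// exprn_ge0.
have lu n : (fun x => l x - u n x) \in L2fun.
  apply: Lfun2P; first by apply: measurable_funB => //; exact: L2_measurable.
  by rewrite (le_lt_trans (dist n))// ltry.
have lL : l \in L2fun.
  have := Lfun2D (lu 0%N) (L2_Lfun (u 0%N)).
  by under eq_fun do rewrite subrK.
exists (L2class mu l).
apply: (@hcvg_le _ _ _ _ _ (fun n => 2 * 2^-1 ^+ n)) => [n|].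
  rewrite (hnormC ip) -[u n]L2classK -L2classB ?L2_Lfun//.
  rewrite -ler_sqr ?nnegrE ?hnorm_ge0 ?mulr_ge0 ?exprn_ge0//.
  by rewrite -lee_fin hnorm_class_sqr.
rewrite -[X in _ --> X](mulr0 2); apply: cvgM; first exact: cvg_cst.
by apply: cvg_expr; rewrite ger0_norm//; lra.
Qed.

End complete.

(** * Time integrals of a stationary process *)

Lemma ge0_integral_law d d' (T : measurableType d) (Om : measurableType d') (R : realType)
    (mu : {measure set T -> \bar R}) (Q : {measure set Om -> \bar R}) (Z : Om -> T)
    (f : T -> \bar R) :
  measurable_fun setT Z -> (forall B, measurable B -> pushforward Q Z B = mu B) ->
  measurable_fun setT f -> (forall x, 0 <= f x)%E ->
  (\int[Q]_w f (Z w) = \int[mu]_x f x)%E.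
Proof.
move=> mZ ZQ mf f0.
have := ge0_integral_pushforward mZ Q measurableT mf (fun y _ => f0 y).
rewrite preimage_setT => <-.
by apply: eq_measure_integral => A mA _; exact: ZQ.
Qed.

(* Minimize [\int (h - a)^2 >= 0] over [a]. *)
Lemma sqr_Rintegral_le d (T : measurableType d) (R : realType)
    (m : {measure set T -> \bar R}) (D : set T) (t : R) (h : T -> R) :
  measurable D -> 0 < t -> m D = t%:E ->
  m.-integrable D (EFin \o h) -> m.-integrable D (EFin \o (fun x => h x ^+ 2)) ->
  (\int[m]_(x in D) h x) ^+ 2 <= t * \int[m]_(x in D) (h x ^+ 2).
Proof.
move=> mD t0 Dt ih ih2.
pose a := (\int[m]_(x in D) h x) / t.
have icst c : m.-integrable D (EFin \o (fun=> c)).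
  by apply: measurable_bounded_integrable; [|rewrite Dt ltry| |exact: bounded_cst].
have : 0 <= \int[m]_(x in D) (h x - a) ^+ 2.
  by apply: Rintegral_ge0 => x _; exact: sqr_ge0.
have -> : \int[m]_(x in D) (h x - a) ^+ 2 =
    \int[m]_(x in D) (h x ^+ 2) - 2 * a * \int[m]_(x in D) h x + a ^+ 2 * t.
  under eq_Rintegral do rewrite sqrrB.
  have ih' : m.-integrable D (EFin \o (fun x => (2 * a) * h x)).
    exact: (integrableZl mD (2 * a) ih).
  rewrite -RintegralZl// -RintegralB// -[in RHS](_ : fine (m D) = t); last by rewrite Dt.
  rewrite -Rintegral_cst// -RintegralD//.
    by apply: eq_Rintegral => x _; ring.
  exact: (integrableB mD ih2 ih').
rewrite /a; set i := \int[m]_(x in D) h x; set j := \int[m]_(x in D) (h x ^+ 2).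
have -> : j - 2 * (i / t) * i + (i / t) ^+ 2 * t = (t * j - i ^+ 2) / t by field; rewrite gt_eqF.
by rewrite pmulr_lge0 ?invr_gt0// subr_ge0.
Qed.

Section stationary.
Context d d' (T : measurableType d) (Om : measurableType d') (R : realType).
Context (mu : probability T R) (Q : probability Om R) (Y : R -> Om -> T) (t : R).
Context (mY : measurable_fun setT (fun p : measurableTypeR R * Om => Y p.1 p.2)).
Context (t_gt0 : 0 < t).
Context (Ylaw : forall s, 0 <= s <= t ->
  forall B, measurable B -> pushforward Q (Y s) B = mu B).
Local Notation leb := (@lebesgue_measure R).
Local Notation D := `[0%R, t]%classic.
Local Notation nmu := (hnorm (@L2dot _ _ R mu)).
Local Notation nQ := (hnorm (@L2dot _ _ R Q)).

Definition timeint (g : T -> R) (w : Om) : R := \int[leb]_(s in D) g (Y s w).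

Lemma stationary_measurable s : measurable_fun setT (Y s).
Proof. exact: (measurable_fun_pair2 s mY). Qed.

Lemma stationary_path_measurable w :
  measurable_fun setT (fun s : measurableTypeR R => Y s w).
Proof. exact: (measurable_fun_pair1 w mY). Qed.

Lemma leb_itv : leb D = t%:E.
Proof. by rewrite lebesgue_measure_itv/= lte_fin t_gt0 sube0. Qed.

(** Extension by 0 outside the time interval, so that Tonelli's theorem applies on the whole product
    space. *)
Let F (f : T -> \bar R) : measurableTypeR R * Om -> \bar R :=
  (fun p => f (Y p.1 p.2)) \_ (D `*` setT).

Let mF f : measurable_fun setT f -> measurable_fun setT (F f).
Proof.
move=> mf; apply/(measurable_restrictT _ _).1; first exact: measurableX.
by apply: measurable_funTS; exact: measurableT_comp.
Qed.

Let FE f s w : F f (s, w) = ((fun s => f (Y s w)) \_ D) s.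
Proof. by rewrite /F !patchE; congr (if _ then _ else _); rewrite in_setX in_setT andbT. Qed.

Let F_time f w : (\int[leb]_s F f (s, w) = \int[leb]_(s in D) f (Y s w))%E.
Proof. by rewrite [RHS]integral_mkcond; apply: eq_integral => s _; rewrite FE. Qed.

Lemma measurable_ge0_time (f : T -> \bar R) : measurable_fun setT f ->
  (forall x, 0 <= f x)%E ->
  measurable_fun setT (fun w => \int[leb]_(s in D) f (Y s w))%E.
Proof.
move=> mf f0; have F0 p : (0 <= F f p)%E by apply: erestrict_ge0.
have := measurable_fun_fubini_tonelli_G (m1 := leb) (F f) (mF mf) F0.
by congr measurable_fun; apply/funext => w; exact: F_time.
Qed.

(** Tonelli: by stationarity every time slice contributes the same integral over [mu]. *)
Lemma ge0_integral_time (f : T -> \bar R) : measurable_fun setT f ->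
  (forall x, 0 <= f x)%E ->
  (\int[Q]_w \int[leb]_(s in D) f (Y s w) = t%:E * \int[mu]_x f x)%E.
Proof.
move=> mf f0; have F0 p : (0 <= F f p)%E by apply: erestrict_ge0.
under eq_integral do rewrite -F_time.
rewrite -(fubini_tonelli (m1 := leb) (m2 := Q) (F f) (mF mf) F0).
transitivity (\int[leb]_(s in D) \int[mu]_x f x)%E.
  rewrite [RHS]integral_mkcond; apply: eq_integral => s _.
  rewrite patchE; case: ifPn => [/set_mem|] sD.
    rewrite -(ge0_integral_law (Z := Y s) (Q := Q))//; last 2 first.
    - exact: stationary_measurable.
    - by apply: Ylaw; move: sD; rewrite /= in_itv.
    by apply: eq_integral => w _; rewrite FE patchE mem_set.
  by rewrite integral0_eq// => w _; rewrite FE patchE (negbTE sD).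
by rewrite integral_cst//= leb_itv muleC.
Qed.

Lemma measurable_timeint (g : T -> R) : measurable_fun setT g ->
  measurable_fun setT (timeint g).
Proof.
move=> mg; apply: measurableT_comp => //.
have mg' : measurable_fun setT (EFin \o g) by exact/measurable_EFinP.
rewrite (_ : (fun _ => _) = (fun w => \int[leb]_(s in D) (EFin \o g)^\+ (Y s w) -
  \int[leb]_(s in D) (EFin \o g)^\- (Y s w))%E); last first.
  apply/funext => w; rewrite integralE; congr (_ - _)%E; apply: eq_integral => s _;
    by rewrite ?funeposE ?funenegE.
apply: emeasurable_funB; apply: measurable_ge0_time => //.
- exact: measurable_funepos.
- exact: measurable_funeneg.
Qed.

(** The expectation of the time integral of |g| is t times the integral of |g| over [mu], so this
    time integral is finite almost surely. *)
Lemma ae_integrable_path (g : T -> R) : mu.-integrable setT (EFin \o g) ->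
  {ae Q, forall w, leb.-integrable D (EFin \o (fun s => g (Y s w)))}.
Proof.
move=> /integrableP[mg goo].
have mag : measurable_fun setT (fun x => `|(g x)%:E|%E) by exact: measurableT_comp.
have ig : Q.-integrable setT (fun w => \int[leb]_(s in D) `|(g (Y s w))%:E|)%E.
  apply/integrableP; split.
    exact: (measurable_ge0_time (f := fun x => `|(g x)%:E|%E)).
  under eq_integral do rewrite gee0_abs ?integral_ge0//.
  rewrite (ge0_integral_time (f := fun x => `|(g x)%:E|%E))//.
  by apply: lte_mul_pinfty => //; rewrite lee_fin ltW.
apply: filterS (integrable_ae measurableT ig) => w /(_ I) fw.
apply/integrableP; split; last by move: fw; rewrite ge0_fin_numE// integral_ge0.
apply: measurable_funTS; apply: measurableT_comp => //; apply: measurableT_comp.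
  exact/measurable_EFinP.
exact: stationary_path_measurable.
Qed.

Lemma timeint_linear a (g h : T -> R) :
  mu.-integrable setT (EFin \o g) -> mu.-integrable setT (EFin \o h) ->
  timeint (fun x => a * g x + h x) = (fun w => a * timeint g w + timeint h w) %[ae Q].
Proof.
move=> ig ih; apply: filterS2 (ae_integrable_path ig) (ae_integrable_path ih).
move=> w gw hw _; rewrite /timeint -RintegralZl// -RintegralD//.
exact: (integrableZl _ a gw).
Qed.

Lemma integrable_timeint (g : T -> R) : mu.-integrable setT (EFin \o g) ->
  Q.-integrable setT (EFin \o timeint g).
Proof.
move=> ig; have /integrableP[mg goo] := ig.
have mg' : measurable_fun setT g by exact/measurable_EFinP.
have mag : measurable_fun setT (fun x => `|(g x)%:E|%E) by exact: measurableT_comp.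
apply/integrableP; split; first exact/measurable_EFinP/measurable_timeint.
apply: (@le_lt_trans _ _ (\int[Q]_w \int[leb]_(s in D) `|(g (Y s w))%:E|)%E).
  apply: ae_ge0_le_integral => //.
  - by apply: measurableT_comp => //; exact/measurable_EFinP/measurable_timeint.
  - by move=> w _; exact: integral_ge0.
  - exact: (measurable_ge0_time (f := fun x => `|(g x)%:E|%E)).
  - apply: filterS (ae_integrable_path ig) => w gw _ /=.
    rewrite EFin_normr_Rintegral//.
    by apply: le_abse_integral => //; case/integrableP: gw.
rewrite (ge0_integral_time (f := fun x => `|(g x)%:E|%E))//.
by apply: lte_mul_pinfty => //; rewrite lee_fin ltW.
Qed.

Lemma Rintegral_timeint (g : T -> R) : mu.-integrable setT (EFin \o g) ->
  \int[Q]_w timeint g w = t * \int[mu]_x g x.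
Proof.
move=> ig; have /integrableP[mg goo] := ig.
have mg' : measurable_fun setT g by exact/measurable_EFinP.
(* Positive and negative parts as real functions; each is treated by Tonelli's theorem, and
   [timeint_linear] recombines them almost everywhere. *)
pose gp x := (`|g x| + g x) / 2; pose gn x := (`|g x| - g x) / 2.
have mgp : measurable_fun setT gp.
  by apply: measurable_funM => //; apply: measurable_funD => //; exact: measurableT_comp.
have mgn : measurable_fun setT gn.
  by apply: measurable_funM => //; apply: measurable_funB => //; exact: measurableT_comp.
have ge0p x : 0 <= gp x by have := ler_norm (- g x); rewrite normrN /gp; lra.
have ge0n x : 0 <= gn x by have := ler_norm (g x); rewrite /gn; lra.
have igp : mu.-integrable setT (EFin \o gp).
  apply: le_integrable ig => //; first exact/measurable_EFinP.
  by move=> x _ /=; rewrite lee_fin ger0_norm// /gp; have := ler_norm (g x); lra.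
have ign : mu.-integrable setT (EFin \o gn).
  apply: le_integrable ig => //; first exact/measurable_EFinP.
  move=> x _ /=; rewrite lee_fin ger0_norm// /gn; have := ler_norm (- g x).
  by rewrite normrN; lra.
have pos (k : T -> R) : measurable_fun setT k -> (forall x, 0 <= k x) ->
    mu.-integrable setT (EFin \o k) -> \int[Q]_w timeint k w = t * \int[mu]_x k x.
  move=> mk k0 ik; apply: EFin_inj; rewrite /Rintegral fineK; last first.
    exact: (integrable_fin_num _ (integrable_timeint ik)).
  rewrite EFinM fineK; last exact: (integrable_fin_num _ ik).
  rewrite -(ge0_integral_time (f := EFin \o k))//; last exact/measurable_EFinP.
  apply: ae_eq_integral => //.
  - exact/measurable_EFinP/measurable_timeint.
  - by apply: measurable_ge0_time => //; exact/measurable_EFinP.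
  - apply: filterS (ae_integrable_path ik) => w kw _ /=.
    by rewrite fineK//; exact: (integrable_fin_num _ kw).
have -> : g = (fun x => (-1) * gn x + gp x) by apply/funext => x; rewrite /gp /gn; lra.
rewrite (@ae_eq_Rintegral _ _ _ _ _ (fun w => (-1) * timeint gn w + timeint gp w)).
- rewrite RintegralD//; last 2 first.
  + exact: (integrableZl _ (-1) (integrable_timeint ign)).
  + exact: integrable_timeint.
  rewrite RintegralZl//; last exact: integrable_timeint.
  rewrite [in RHS]RintegralD//; last exact: (integrableZl _ (-1) ign).
  by rewrite [in RHS]RintegralZl// !pos//; ring.
- apply: measurable_timeint; apply: measurable_funD => //.
  by apply: measurable_funM => //; exact: measurable_cst.
- apply: measurable_funD; last exact: measurable_timeint.
  by apply: measurable_funM; [exact: measurable_cst|exact: measurable_timeint].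
- exact: timeint_linear.
Qed.

(** One factor [t] comes from Cauchy-Schwarz in time on almost every path, the other from
    stationarity. *)
Lemma integral_sqr_timeint_le (g : T -> R) : g \in Lfun mu 2%:E ->
  (\int[Q]_w (timeint g w ^+ 2)%:E <= (t ^+ 2)%:E * \int[mu]_x (g x ^+ 2)%:E)%E.
Proof.
move=> gL; have mg := Lfun_measurable gL.
have ig := Lfun2_integrable gL; have ig2 := Lfun2_integrable_sqr gL.
have mg2 : measurable_fun setT (fun x => (g x ^+ 2)%:E).
  by apply/measurable_EFinP; exact: measurable_funX.
have g20 x : (0 <= (g x ^+ 2)%:E)%E by rewrite lee_fin sqr_ge0.
rewrite expr2 EFinM -muleA -(ge0_integral_time mg2 g20).
rewrite -ge0_integralZl//; last 3 first.
- exact: (measurable_ge0_time mg2 g20).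
- by move=> w _; exact: integral_ge0.
- by rewrite lee_fin ltW.
apply: ae_ge0_le_integral => //.
- by move=> w _; rewrite lee_fin sqr_ge0.
- by apply/measurable_EFinP; apply: measurable_funX; exact: measurable_timeint.
- move=> w _; apply: mule_ge0; first by rewrite lee_fin ltW.
  by apply: integral_ge0 => s _; rewrite lee_fin sqr_ge0.
- by apply: emeasurable_funM; [exact: measurable_cst|exact: (measurable_ge0_time mg2 g20)].
- apply: filterS2 (ae_integrable_path ig) (ae_integrable_path ig2) => w gw gw2 _.
  have := sqr_Rintegral_le _ t_gt0 leb_itv gw gw2.
  rewrite -lee_fin => /(_ (measurable_itv _)) /le_trans; apply.
  by rewrite EFinM /Rintegral fineK//; exact: (integrable_fin_num _ gw2).
Qed.

Lemma Lfun_timeint (g : T -> R) : g \in Lfun mu 2%:E -> timeint g \in Lfun Q 2%:E.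
Proof.
move=> gL; apply: Lfun2P; first exact/measurable_timeint/(Lfun_measurable gL).
apply: le_lt_trans (integral_sqr_timeint_le gL) _.
by rewrite -hnorm_class_sqr// -EFinM ltry.
Qed.

Lemma hnorm_timeint_le (g : T -> R) : g \in Lfun mu 2%:E ->
  nQ (L2class Q (timeint g)) <= t * nmu (L2class mu g).
Proof.
move=> gL; rewrite -ler_sqr ?nnegrE ?mulr_ge0 ?hnorm_ge0 ?(ltW t_gt0)//.
rewrite -lee_fin exprMn [leRHS]EFinM !hnorm_class_sqr//; last exact: Lfun_timeint.
exact: integral_sqr_timeint_le.
Qed.

Lemma Lfun_law s (g : T -> R) : 0 <= s <= t -> g \in Lfun mu 2%:E ->
  (fun w => g (Y s w)) \in Lfun Q 2%:E /\
  nQ (L2class Q (fun w => g (Y s w))) = nmu (L2class mu g).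
Proof.
move=> st gL; have mg := Lfun_measurable gL.
have mgs : measurable_fun setT (fun w => g (Y s w)).
  by apply: measurableT_comp => //; exact: stationary_measurable.
have E : (\int[Q]_w (g (Y s w) ^+ 2)%:E = \int[mu]_x (g x ^+ 2)%:E)%E.
  apply: (ge0_integral_law (f := fun x => (g x ^+ 2)%:E)).
  - exact: stationary_measurable.
  - exact: Ylaw.
  - by apply/measurable_EFinP; exact: measurable_funX.
  - by move=> x; rewrite lee_fin sqr_ge0.
have gsL : (fun w => g (Y s w)) \in Lfun Q 2%:E.
  by apply: Lfun2P => //; rewrite E -hnorm_class_sqr// ltry.
split => //; apply/eqP; rewrite -(eqrXn2 (_ : 0 < 2)%N) ?hnorm_ge0//; apply/eqP/EFin_inj.
by rewrite !hnorm_class_sqr.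
Qed.

Definition timeintH (f : LspaceType2 mu) : LspaceType2 Q := L2class Q (timeint f).

Definition evalH s (f : LspaceType2 mu) : LspaceType2 Q := L2class Q (fun w => f (Y s w)).

(** The difference of the two time integrals has norm at most t times that of [g - h], which is 0.
    This makes [timeintH] independent of the version of its argument. *)
Lemma timeint_ae (g h : T -> R) : g \in Lfun mu 2%:E -> h \in Lfun mu 2%:E ->
  g = h %[ae mu] -> L2class Q (timeint g) = L2class Q (timeint h).
Proof.
move=> gL hL gh; apply/eqP; rewrite -subr_eq0; apply/eqP/(hnorm_eq0 (L2dot_inner_product Q)).
apply/eqP; rewrite eq_le hnorm_ge0 andbT.
have hgL := Lfun2_lin (-1) hL gL.
have -> : L2class Q (timeint g) - L2class Q (timeint h) =
    L2class Q (timeint (fun x => -1 * h x + g x)).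
  rewrite addrC -scaleN1r -L2class_linear ?Lfun_timeint//.
  apply: eq_L2class; [by apply: Lfun2_lin; exact: Lfun_timeint|exact: Lfun_timeint|].
  by apply/ae_eq_sym; apply: timeint_linear; exact: Lfun2_integrable.
apply: le_trans (hnorm_timeint_le hgL) _.
rewrite (_ : L2class mu _ = 0); first by rewrite (hnorm0 (L2dot_inner_product mu)) mulr0.
apply: L2_eqP; apply: filterS3 (L2classE hgL) gh (L2zero_ae mu).
by move=> x + e1 e2 _ => <-//; rewrite e1// e2// mulN1r addNr.
Qed.

Lemma timeintHE (g : T -> R) : g \in Lfun mu 2%:E ->
  timeintH (L2class mu g) = L2class Q (timeint g).
Proof.
move=> gL; apply: timeint_ae => //; first exact: L2_Lfun.
exact/ae_eq_sym/L2classE.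
Qed.

Lemma timeintH_linear a f g : timeintH (a *: f + g) = a *: timeintH f + timeintH g.
Proof.
have fgL := Lfun2_lin a (L2_Lfun f) (L2_Lfun g).
rewrite -[f in LHS]L2classK -[g in LHS]L2classK -L2class_linear ?L2_Lfun//.
rewrite timeintHE// -L2class_linear ?Lfun_timeint ?L2_Lfun//.
apply: eq_L2class; [exact: Lfun_timeint| |].
- by apply: Lfun2_lin; apply: Lfun_timeint; exact: L2_Lfun.
- by apply: timeint_linear; apply: Lfun2_integrable; exact: L2_Lfun.
Qed.

Lemma hnorm_timeintH f : nQ (timeintH f) <= t * nmu f.
Proof. by rewrite -[f in leRHS]L2classK; apply: hnorm_timeint_le; exact: L2_Lfun. Qed.

Lemma hnorm_evalH s f : 0 <= s <= t -> nQ (evalH s f) = nmu f.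
Proof. by move=> st; rewrite -[f in RHS]L2classK; apply: (Lfun_law st _).2; exact: L2_Lfun. Qed.

End stationary.

(** * Path spaces *)

Lemma opp_shift_preimage_itvoc (R : realType) (t a b : R) :
  (fun s : R => t - s) @^-1` `]a, b]%classic = `[t - b, t - a[%classic.
Proof.
by apply/seteqP; split => s /=; rewrite !in_itv/= => /andP[h1 h2]; apply/andP; split; lra.
Qed.

(** By uniqueness of Lebesgue measure it suffices to look at half-open intervals; reflection
    exchanges their open and closed ends but keeps their length. *)
Lemma lebesgue_measure_reflect (R : realType) (t : R) (A : set R) : measurable A ->
  pushforward lebesgue_measure (fun s : measurableTypeR R => (t - s) : measurableTypeR R) A =
  lebesgue_measure A.
Proof.
have mr : measurable_fun setT (fun s : measurableTypeR R => (t - s) : measurableTypeR R).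
  exact: measurable_funB.
move=> mA; apply/esym/lebesgue_measure_unique => //= _ [[a b]] _ <-.
rewrite /pushforward opp_shift_preimage_itvoc !lebesgue_measure_itv/=.
by rewrite !lte_fin ltrD2l ltrN2 -!EFinB; congr (if _ then (_%:E) else _); ring.
Qed.

Lemma Rintegral_reflect (R : realType) (t : R) (h : R -> R) :
  measurable_fun setT (h : measurableTypeR R -> R) ->
  \int[lebesgue_measure]_(s in `[0, t]) h (t - s) =
  \int[lebesgue_measure]_(s in `[0, t]) h s.
Proof.
move=> mh.
have mr : measurable_fun setT (fun s : measurableTypeR R => (t - s) : measurableTypeR R).
  exact: measurable_funB.
have mh' : measurable_fun setT (EFin \o (h : measurableTypeR R -> R)) by exact/measurable_EFinP.
have preim : (fun s : measurableTypeR R => (t - s) : measurableTypeR R) @^-1` `[0, t]%classic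
    = `[0, t]%classic.
  by apply/seteqP; split => s /=; rewrite !in_itv/= => /andP[h1 h2]; apply/andP; split; lra.
have ge0_reflect (f : measurableTypeR R -> \bar R) : measurable_fun setT f ->
    (forall x, 0 <= f x)%E ->
    (\int[lebesgue_measure]_(s in `[0%R, t]) f (t - s)%R =
     \int[lebesgue_measure]_(s in `[0%R, t]) f s)%E.
  move=> mf f0.
  have := ge0_integral_pushforward mr lebesgue_measure (measurable_itv `[0, t])
    (measurable_funTS mf) (fun y _ => f0 y).
  rewrite preim => <-.
  by apply: eq_measure_integral => A mA _; exact: lebesgue_measure_reflect.
congr fine; rewrite integralE [RHS]integralE; congr (_ - _)%E.
- rewrite -(ge0_reflect (EFin \o h)^\+%E)//; last exact: measurable_funepos.
  by apply: eq_integral => s _; rewrite !funeposE.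
- rewrite -(ge0_reflect (EFin \o h)^\-%E)//; last exact: measurable_funeneg.
  by apply: eq_integral => s _; rewrite !funenegE.
Qed.

(** * Measurability of continuous paths jointly in time and path *)

Section path_measurability.
Context (R : realType) (E : pmetricType R) (I : set R).

Lemma measurable_path_eval (s : I) :
  measurable_fun setT (fun w : path_space I E => (w : continuousType I E) s : borel E).
Proof.
move=> _ B mB; rewrite setTI; apply: sub_sigma_algebra; exists s => //; exists B => //.
by rewrite setTI.
Qed.

Lemma measurable_into_path_space d (Om : measurableType d) (f : Om -> path_space I E) :
  (forall s : I, measurable_fun setT (fun w => (f w : continuousType I E) s : borel E)) ->
  measurable_fun setT f.
Proof.
move=> mf; refine (@measurability _ _ Om (path_space I E) setT f (@cylinders R I E setT) erefl _).
move=> _ [_ [s _ [B mB <-]] <-]; rewrite !setTI.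
by have := mf s measurableT B mB; rewrite setTI.
Qed.

Context (c : R -> I).
Context (cc : continuous c).
Local Notation grid n r := ((Num.floor (n.+1%:R * r))%:~R / n.+1%:R : R).

(** [grid n r] is [r] rounded down to a multiple of 1 / (n + 1). *)
Lemma grid_cvg (r : R) : grid n r @[n --> \oo] --> r.
Proof.
apply/cvgrPdist_le => e e0.
have h0 := @cvg_harmonic R.
move/cvgrPdist_le: h0 => /(_ _ e0); apply: filterS => n; rewrite /= sub0r normrN => hn.
apply: le_trans hn; rewrite [X in _ <= X]ger0_norm; last by rewrite invr_ge0.
have n0 : 0 < n.+1%:R :> R by [].
have /andP[h1 h2] := floor_itv (n.+1%:R * r).
have -> : r - grid n r = (n.+1%:R * r - (Num.floor (n.+1%:R * r))%:~R) / n.+1%:R.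
  by rewrite mulrBl mulrAC mulfV ?gt_eqF// mul1r.
rewrite normrM ger0_norm ?subr_ge0// (ger0_norm (_ : 0 <= n.+1%:R^-1)) ?invr_ge0//.
rewrite ler_piMl ?invr_ge0// lerBlDl addrC; apply: ltW.
by rewrite -[X in _ < X]addrC; move: h2; rewrite intrD.
Qed.

(** A discretized time takes countably many values, so the set is a countable union of products of a
    time interval and a cylinder at a fixed time. *)
Lemma measurable_grid_eval n B : @measurable _ (borel E) B ->
  measurable [set p : measurableTypeR R * path_space I E |
    B ((p.2 : continuousType I E) (c (grid n p.1)))].
Proof.
move=> mB.
(* The default 0 for numbers that code no integer merely repeats a member of the union. *)
pose z (m : nat) : int := odflt 0 (unpickle m).
rewrite (_ : [set p | _] = \bigcup_m
  ([set r : R | Num.floor (n.+1%:R * r) = z m] `*`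
   [set w : path_space I E | B ((w : continuousType I E) (c ((z m)%:~R / n.+1%:R)))])); last first.
  apply/seteqP; split=> [[r w] /= Brw|[r w] [m _ [/= <- //]]].
  exists (pickle (Num.floor (n.+1%:R * r))) => //=.
  by rewrite /z pickleK.
apply: bigcup_measurable => m _; apply: measurableX.
- rewrite (_ : [set r | _] = (fun r : R => n.+1%:R * r) @^-1` `[(z m)%:~R, (z m + 1)%:~R[%classic).
    rewrite -[_ @^-1` _]setTI.
    have mm : measurable_fun setT (fun r : R => n.+1%:R * r) by exact: measurable_funM.
    exact: mm.
  apply/seteqP; split=> r /=; rewrite in_itv/=.
  + by move=> <-; exact: floor_itv.
  + by move=> h; exact: floor_def.
- have := measurable_path_eval (c ((z m)%:~R / n.+1%:R)) measurableT mB.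
  by rewrite setTI.
Qed.

Let shrink (U : set E) (m : nat) : set E := [set x | ball x m.+1%:R^-1 `<=` U].

(** The complement is open: if [y] outside [U] lies in the open ball around [x], it also lies in the
    balls around all points close to [x]. *)
Let measurable_shrink U m : @measurable _ (borel E) (shrink U m).
Proof.
rewrite -[shrink U m]setCK; apply: measurableC; apply: sub_sigma_algebra.
rewrite openE => x /= /existsNP[y] /not_implyP[xy nUy].
rewrite /interior -nbhs_ballE; move: xy; rewrite ballEmdist /= => xy.
exists (m.+1%:R^-1 - mdist x y); rewrite /= ?subr_gt0// => z.
rewrite ballEmdist /= => xz; apply/existsNP; exists y; apply/not_implyP; split => //.
rewrite ballEmdist /= (le_lt_trans (metric_triangle z x y))// (metric_sym z x).
by rewrite -ltrBrDr.
Qed.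

(* A path enters an open set [U] at time [r] iff its discretizations eventually
   stay in some set of points at a fixed distance from the complement of [U]. *)
Lemma measurable_clamped_path :
  measurable_fun setT (fun p : measurableTypeR R * path_space I E =>
    (p.2 : continuousType I E) (c p.1) : borel E).
Proof.
refine (@measurability _ _ _ (borel E) setT (fun p : measurableTypeR R * path_space I E =>
  (p.2 : continuousType I E) (c p.1)) (@open E) erefl _).
move=> _ [U oU <-]; rewrite setTI.
rewrite (_ : _ @^-1` _ = \bigcup_m \bigcup_N \bigcap_(n in [set n | (N <= n)%N])
  [set p : measurableTypeR R * path_space I E |
    shrink U m ((p.2 : continuousType I E) (c (grid n p.1)))]).
  apply: bigcup_measurable => m _; apply: bigcup_measurable => N _.
  by apply: bigcap_measurable => [|n _]; [exists N => /=|exact: measurable_grid_eval].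
have pathcvg r (w : path_space I E) :
    (w : continuousType I E) (c (grid n r)) @[n --> \oo] --> (w : continuousType I E) (c r).
  have wc : {for r, continuous ((w : continuousType I E) \o c)}.
    by apply: continuous_comp; [exact: cc|exact: cts_fun].
  exact: (cvg_comp _ _ (@grid_cvg r) wc).
apply/seteqP; split=> [[r w] /= Urw|[r w] [m _ [N _ /= H]]].
(* Half of the radius [e] serves for the distance to the complement of [U], the other half for the
   convergence of the discretized path. *)
- have := oU; rewrite openE => /(_ _ Urw); rewrite /interior -nbhs_ballE => -[e /= e0 eU].
  have e20 : 0 < e / 2 by rewrite divr_gt0.
  have /cvgrPdist_lt/(_ _ e20)[m _ /(_ m (leqnn m)) /= me] := @cvg_harmonic R.
  rewrite sub0r normrN ger0_norm ?invr_ge0// in me.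
  have /cvg_ballP/(_ _ e20)[N _ HN] := pathcvg r w.
  exists m => //; exists N => // n /= /HN /= Hn y yn.
  apply: eU; rewrite (splitr e); apply: ball_triangle Hn _.
  by apply: (le_ball _ yn); exact: ltW.
- have m0 : 0 < m.+1%:R^-1 :> R by rewrite invr_gt0.
  have /cvg_ballP/(_ _ m0)[N' _ HN'] := pathcvg r w.
  apply: (H (maxn N N')); first exact: leq_maxl.
  by apply: ball_sym; apply: HN' => /=; exact: leq_maxr.
Qed.

End path_measurability.

Section clamped_paths.
Context (R : realType) (E : pmetricType R).

Lemma clamp_subproof (r : R) : Num.max r 0 \in infinite_horizon R.
Proof. by rewrite inE /infinite_horizon /= in_itv/= andbT le_max lexx orbT. Qed.

Definition clamp (r : R) : infinite_horizon R := exist _ (Num.max r 0) (clamp_subproof r).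

Lemma clamp_continuous : continuous clamp.
Proof.
apply: continuous_comp_initial => r.
by apply: (@continuous_max _ _ (fun r : R => r) (fun=> 0)); [exact: cvg_id|exact: cst_continuous].
Qed.

(** At negative times [X] is a default point, whereas here the path is frozen at its value at time
    0. It thus stays continuous on the whole line, as joint measurability demands. *)
Definition path_at (s : R) (w : paths E) : borel E := (w : continuousType _ _) (clamp s).

Lemma XE s (w : paths E) : 0 <= s -> X s w = path_at s w.
Proof.
move=> s0; rewrite /X /path_at.
have e : set_val (clamp s) = s by exact: max_l.
by have := congr1 (@^~ (clamp s)) (valLK point (w : infinite_horizon R -> E)); rewrite /sigL /= e.
Qed.

Lemma measurable_path_at : measurable_fun setT
  (fun p : measurableTypeR R * paths E => path_at p.1 p.2).
Proof. exact: (measurable_clamped_path clamp_continuous). Qed.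

Lemma finite_clamp_subproof (t : R) (t0 : 0 <= t) (r : R) :
  Num.min (Num.max r 0) t \in finite_horizon t.
Proof.
by rewrite inE /finite_horizon /= in_itv/= le_min le_max lexx orbT t0 ge_min lexx orbT.
Qed.

(** Freezing time at both ends makes [measurable_clamped_path] available for a finite horizon
    too. *)
Definition finite_clamp (t : R) (t0 : 0 <= t) (r : R) : finite_horizon t :=
  exist _ (Num.min (Num.max r 0) t) (finite_clamp_subproof t0 r).

Lemma finite_clamp_continuous t (t0 : 0 <= t) : continuous (finite_clamp t0).
Proof.
apply: continuous_comp_initial => r.
apply: (@continuous_min _ _ (fun r : R => Num.max r 0) (fun=> t)); last exact: cst_continuous.
by apply: (@continuous_max _ _ (fun r : R => r) (fun=> 0)); [exact: cvg_id|exact: cst_continuous].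
Qed.

Lemma measurable_path_restrict t : measurable_fun setT (@path_restrict R E t).
Proof.
by apply: measurable_into_path_space => s; exact: (measurable_path_eval (extend_time s)).
Qed.

Lemma measurable_path_reverse t : measurable_fun setT (@path_reverse R E t).
Proof.
by apply: measurable_into_path_space => s; exact: (measurable_path_eval (reverse_time s)).
Qed.

Lemma finite_clampK t (t0 : 0 <= t) s : 0 <= s <= t -> set_val (finite_clamp t0 s) = s.
Proof.
move=> /andP[s0 st]; transitivity (Num.min (Num.max s 0) t) => //.
by rewrite (max_l s0) min_l.
Qed.

Lemma path_restrict_clamp t (t0 : 0 <= t) s (w : paths E) : 0 <= s <= t ->
  (path_restrict t w : continuousType _ _) (finite_clamp t0 s) = path_at s w.
Proof.
move=> st; rewrite /path_at /path_restrict /=; congr ((w : continuousType _ _) _).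
apply: val_inj; transitivity s; first exact: finite_clampK.
by apply/esym/max_l; case/andP: st.
Qed.

Lemma path_reverse_clamp t (t0 : 0 <= t) s (w : paths E) : 0 <= s <= t ->
  (path_reverse (path_restrict t w) : continuousType _ _) (finite_clamp t0 s) =
  path_at (t - s) w.
Proof.
move=> st; rewrite /path_at /path_restrict /path_reverse /=.
congr ((w : continuousType _ _) _); apply: val_inj; transitivity (t - s).
  by rewrite -[in RHS](finite_clampK t0 st).
by apply/esym/max_l; rewrite subr_ge0; case/andP: st.
Qed.

End clamped_paths.

(** * Forward and backward martingales *)

(** Used with [a] and [b] the values of [f] at the end and at the start of the path, [p] and [q] the
    time integrals of the generator and of its reversed counterpart. *)
Lemma boundary_cancel (V : zmodType) (a b p q : V) :
  p + q = - ((a - b - p) + (b - a - q)).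
Proof. by rewrite addrACA -(opprB a b) subrr add0r opprD !opprK. Qed.

Section path_functionals.
Context (R : realType) (E : pmetricType R) (mu : probability (borel E) R).
Local Notation H := (LspaceType2 mu).
Local Notation dot := (@L2dot _ _ R mu).
Local Notation nmu := (hnorm dot).
Local Notation pathY := (@path_at R E).

(* The martingale [Mproc] with [L f] replaced by an arbitrary [g], along [path_at]. *)
Definition Mfun (f g : borel E -> R) (t : R) (w : paths E) : R :=
  f (path_at t w) - f (path_at 0 w) - timeint pathY t g w.

(** [Mfun] evaluated on the reversed path: the end points are exchanged and the time integral is
    unchanged. *)
Definition Mfun_reversed (f g : borel E -> R) (t : R) (w : paths E) : R :=
  f (path_at 0 w) - f (path_at t w) - timeint pathY t g w.

Lemma timeint_path_at t (g : borel E -> R) (w : paths E) :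
  \int[lebesgue_measure]_(s in `[0, t]) g (X s w) = timeint pathY t g w.
Proof.
by apply: eq_Rintegral => s /set_mem /=; rewrite in_itv/= => /andP[s0 _]; rewrite XE.
Qed.

Section one_law.
Context (Q : probability (paths E) R) (t : R).
Context (Qinv : invariant_law mu Q) (t_gt0 : 0 < t).
Local Notation nQ := (hnorm (@L2dot _ _ R Q)).

Lemma path_at_law s : 0 <= s <= t -> forall B, measurable B ->
  pushforward Q (pathY s) B = mu B.
Proof.
move=> /andP[s0 _] B mB; rewrite -(Qinv s0 mB) /pushforward; congr (Q _).
by apply/seteqP; split => w /=; rewrite XE.
Qed.

Local Notation mY := (@measurable_path_at R E).
Local Notation t0 := (ltW t_gt0).

Lemma Lfun_path_at s (f : borel E -> R) : 0 <= s <= t -> f \in Lfun mu 2%:E ->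
  (fun w => f (path_at s w)) \in Lfun Q 2%:E.
Proof. by move=> st fL; exact: (Lfun_law mY path_at_law st fL).1. Qed.

Lemma Lfun_time (f : borel E -> R) : f \in Lfun mu 2%:E -> timeint pathY t f \in Lfun Q 2%:E.
Proof. exact: (Lfun_timeint mY t_gt0 path_at_law). Qed.

Let tt : 0 <= t <= t. Proof. by rewrite lexx t0. Qed.
Let zt : 0 <= (0 : R) <= t. Proof. by rewrite lexx t0. Qed.

Lemma Lfun_Mfun (f g : borel E -> R) : f \in Lfun mu 2%:E -> g \in Lfun mu 2%:E ->
  Mfun f g t \in Lfun Q 2%:E.
Proof.
by move=> fL gL; apply: Lfun2B; [apply: Lfun2B; exact: Lfun_path_at|exact: Lfun_time].
Qed.

Lemma Lfun_Mfun_reversed (f g : borel E -> R) : f \in Lfun mu 2%:E -> g \in Lfun mu 2%:E ->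
  Mfun_reversed f g t \in Lfun Q 2%:E.
Proof.
by move=> fL gL; apply: Lfun2B; [apply: Lfun2B; exact: Lfun_path_at|exact: Lfun_time].
Qed.

Lemma MfunE (f g : H) : L2class Q (Mfun f g t) =
  evalH Q pathY t f - evalH Q pathY 0 f - timeintH Q pathY t g.
Proof.
have f0 := Lfun_path_at zt (L2_Lfun f); have ft := Lfun_path_at tt (L2_Lfun f).
by rewrite /Mfun L2classB ?Lfun2B ?Lfun_time ?L2_Lfun// L2classB.
Qed.

Lemma Mfun_reversedE (f g : H) : L2class Q (Mfun_reversed f g t) =
  evalH Q pathY 0 f - evalH Q pathY t f - timeintH Q pathY t g.
Proof.
have f0 := Lfun_path_at zt (L2_Lfun f); have ft := Lfun_path_at tt (L2_Lfun f).
by rewrite /Mfun_reversed L2classB ?Lfun2B ?Lfun_time ?L2_Lfun// L2classB.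
Qed.

Lemma Rintegral_set1T (h : R -> R) : \int[lebesgue_measure]_(s in `[0, 0]) h s = 0.
Proof. by rewrite set_itv1 Rintegral_set1. Qed.

(** [Nproc] has the same expectation at time [t] as at time 0, so the second moment of the
    martingale is 2 t times the integral of [Gamma L f]. In that integral [L] of the square of [f]
    vanishes by invariance, which leaves [- dot (L f) f]. *)
Lemma Mfun_energy (L : H -> H) (f : H) :
  (fun x => f x * f x) \in Lfun mu 2%:E ->
  \int[mu]_x L (L2class mu (fun y => f y * f y)) x = 0 ->
  martingale Q (@natural_filtration R E) (Nproc L f) ->
  nQ (L2class Q (Mfun f (L f) t)) ^+ 2 = 2 * t * - dot (L f) f.
Proof.
move=> ffL Lff0 [intN condN].
(* The conditional expectation at time 0 is tested on the whole space. *)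
have [_ _ /(_ setT)] := condN 0 t (lexx 0) t0.
have -> : (\int[Q]_w (Nproc L f 0 w)%:E = 0)%E.
  apply: integral0_eq => w _; rewrite /Nproc /Mproc !Rintegral_set1T.
  by rewrite subrr subr0 expr0n mulr0 subr0.
have FT : @natural_filtration R E 0 setT.
  exact: (@measurableT _ (g_sigma_algebraType
    (@cylinders R _ E [set s : infinite_horizon R | set_val s <= 0]))).
move=> /(_ FT) N0.
have mL := Lfun_Mfun (L2_Lfun f) (L2_Lfun (L f)).
have im2 := Lfun2_integrable_sqr mL.
have iLff := Lfun2_integrable (L2_Lfun (L (L2class mu (fun y => f y * f y)))).
have ifLf := Lfun2_integrableM (L2_Lfun f) (L2_Lfun (L f)).
have GE : Gamma L f = (fun x =>
    2^-1 * L (L2class mu (fun y => f y * f y)) x + (-1) * (f x * L f x)).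
  by apply/funext => x; rewrite /Gamma; field.
have i1 : mu.-integrable setT (EFin \o (fun x => 2^-1 * L (L2class mu (fun y => f y * f y)) x)).
  exact: (integrableZl _ 2^-1 iLff).
have i2 : mu.-integrable setT (EFin \o (fun x => (-1) * (f x * L f x))).
  exact: (integrableZl _ (-1) ifLf).
have iG : mu.-integrable setT (EFin \o Gamma L f).
  by rewrite GE; exact: (integrableD _ i1 i2).
have intG : \int[mu]_x Gamma L f x = - dot (L f) f.
  rewrite GE RintegralD// RintegralZl// RintegralZl// Lff0 mulr0 add0r mulN1r.
  by congr (- _); apply: eq_Rintegral => x _; rewrite mulrC.
have itG := integrable_timeint mY t_gt0 path_at_law iG.
have NE w : Nproc L f t w = Mfun f (L f) t w ^+ 2 - 2 * timeint pathY t (Gamma L f) w.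
  by rewrite /Nproc /Mproc !timeint_path_at (XE _ t0) (XE _ (lexx 0)).
have : \int[Q]_w (Mfun f (L f) t w ^+ 2 - 2 * timeint pathY t (Gamma L f) w) = 0.
  rewrite /Rintegral (eq_integral (EFin \o Nproc L f t)); last by move=> w _; rewrite /= NE.
  by rewrite -N0.
rewrite RintegralB//; last exact: (integrableZl _ 2 itG).
rewrite RintegralZl// (Rintegral_timeint mY t_gt0 path_at_law iG) intG.
move/eqP; rewrite subr_eq0 mulrA => /eqP <-.
by apply: EFin_inj; rewrite hnorm_class_sqr// /Rintegral fineK//; exact: (integrable_fin_num _ im2).
Qed.

End one_law.

(** * Transfer of norms under time reversal *)

Section time_reversal.
Context (Q Qhat : probability (paths E) R) (t : R).
Context (Qinv : invariant_law mu Q) (Qhatinv : invariant_law mu Qhat).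
Context (rev : time_reversal Q Qhat) (t_gt0 : 0 < t).
Local Notation t0 := (ltW t_gt0).

Let Yfin (s : R) (w : path_space (finite_horizon t) E) : borel E :=
  (w : continuousType _ _) (finite_clamp t0 s).

(** One functional on paths with horizon [t] for both directions: on the restricted path it is
    [Mfun], on the reversed one [Mfun_reversed]. *)
Let Psi (f g : borel E -> R) (w : path_space (finite_horizon t) E) : R :=
  f (Yfin t w) - f (Yfin 0 w) - timeint Yfin t g w.

Let measurable_Yfin : measurable_fun setT
  (fun p : measurableTypeR R * path_space (finite_horizon t) E => Yfin p.1 p.2).
Proof. exact: (measurable_clamped_path (@finite_clamp_continuous R t t0)). Qed.

Let measurable_Psi f g : measurable_fun setT f -> measurable_fun setT g ->
  measurable_fun setT (Psi f g).
Proof.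
move=> mf mg; apply: measurable_funB; last first.
  exact: (@measurable_timeint _ _ _ _ _ Yfin t measurable_Yfin g mg).
by apply: measurable_funB; apply: measurableT_comp => //;
  exact: (stationary_measurable measurable_Yfin).
Qed.

Let tt : 0 <= t <= t. Proof. by rewrite lexx t0. Qed.
Let zt : 0 <= (0 : R) <= t. Proof. by rewrite lexx t0. Qed.

Let Psi_restrict f g w : Psi f g (path_restrict t w) = Mfun f g t w.
Proof.
have e s : 0 <= s <= t -> Yfin s (path_restrict t w) = path_at s w.
  exact: path_restrict_clamp.
rewrite /Psi /Mfun !e//; congr (_ - _ - _).
by apply: eq_Rintegral => s /set_mem; rewrite [X in X -> _]/= in_itv => /e ->.
Qed.

Let Psi_reverse f g w : measurable_fun setT g ->
  Psi f g (path_reverse (path_restrict t w)) = Mfun_reversed f g t w.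
Proof.
have e s : 0 <= s <= t -> Yfin s (path_reverse (path_restrict t w)) = path_at (t - s) w.
  exact: path_reverse_clamp.
move=> mg; rewrite /Psi /Mfun_reversed !e// subrr subr0; congr (_ - _ - _).
transitivity (\int[lebesgue_measure]_(s in `[0, t]) (g \o pathY^~ w) (t - s)).
  by apply: eq_Rintegral => s /set_mem; rewrite [X in X -> _]/= in_itv => /e ->.
apply: Rintegral_reflect; apply: measurableT_comp => //.
exact: (stationary_path_measurable (@measurable_path_at R E)).
Qed.

(** The restricted path under [Qhat] and the reversed restricted path under [Q] have the same law,
    and both sides integrate the square of [Psi] against it. *)
Lemma hnorm_Mfun_reversed (f g : H) :
  hnorm (@L2dot _ _ R Q) (L2class Q (Mfun_reversed f g t)) =
  hnorm (@L2dot _ _ R Qhat) (L2class Qhat (Mfun f g t)).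
Proof.
apply/eqP; rewrite -(eqrXn2 (_ : 0 < 2)%N) ?hnorm_ge0//; apply/eqP/EFin_inj.
rewrite !hnorm_class_sqr ?Lfun_Mfun ?Lfun_Mfun_reversed ?L2_Lfun//.
pose Psi2 w := ((Psi f g w) ^+ 2)%:E.
have mPsi2 : measurable_fun setT Psi2.
  by apply/measurable_EFinP; apply: measurable_funX; apply: measurable_Psi; exact: L2_measurable.
have Psi20 w : (0 <= Psi2 w)%E by rewrite lee_fin sqr_ge0.
have mrestr := @measurable_path_restrict R E t.
have mrev : measurable_fun setT (fun w : paths E => path_reverse (path_restrict t w)).
  by apply: measurableT_comp mrestr; exact: measurable_path_reverse.
transitivity (\int[Q]_w Psi2 (path_reverse (path_restrict t w)))%E.
  by apply: eq_integral => w _; rewrite /Psi2 Psi_reverse//; exact: L2_measurable.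
transitivity (\int[Qhat]_w Psi2 (path_restrict t w))%E; last first.
  by apply: eq_integral => w _; rewrite /Psi2 Psi_restrict.
have := ge0_integral_pushforward mrestr Qhat measurableT mPsi2 (fun y _ => Psi20 y).
have := ge0_integral_pushforward mrev Q measurableT mPsi2 (fun y _ => Psi20 y).
rewrite !preimage_setT => <- <-.
by apply: eq_measure_integral => A mA _; apply/esym; exact: (rev t0 mA).
Qed.

End time_reversal.

(** * Bounds for the time integrals of L f and S f *)

Section forward_backward.
Context (D : set H) (S A P : H -> H) (Q Qhat : probability (paths E) R) (t : R).
Context (ana : analytic_setting D S A P) (sto : stochastic_setting D S A Q Qhat).
Context (t_gt0 : 0 < t).
Local Notation nQ := (hnorm (@L2dot _ _ R Q)).
Local Notation ip := (L2dot_inner_product mu).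
Local Notation ipQ := (L2dot_inner_product Q).
Local Notation intH := (timeintH Q pathY t).

Let Qinv : invariant_law mu Q := Q_invariant sto.
Let Qhatinv : invariant_law mu Qhat := Qhat_invariant sto.
Let tlaw := path_at_law Qinv (t := t).

Lemma A_dot0 f : D f -> dot (A f) f = 0.
Proof.
move=> Df; have := A_antisymmetric ana Df Df; rewrite (dotC ip f).
by move=> h; lra.
Qed.

Lemma opL_dot f : D f -> dot (opL S A f) f = dot (S f) f.
Proof. by move=> Df; rewrite /opL (dotBl ip) A_dot0// subr0. Qed.

Lemma opLhat_dot f : D f -> dot (opLhat S A f) f = dot (S f) f.
Proof. by move=> Df; rewrite /opLhat (dotDl ip) A_dot0// addr0. Qed.

Local Notation energy f := (Num.sqrt (2 * t * - dot (S f) f)).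

Let sqrt_energy (x : R) f : 0 <= x -> x ^+ 2 = 2 * t * - dot (S f) f -> x = energy f.
Proof. by move=> x0 <-; rewrite sqrtr_sqr ger0_norm. Qed.

Lemma forward_norm f : D f -> nQ (L2class Q (Mfun f (opL S A f) t)) = energy f.
Proof.
move=> Df; apply: sqrt_energy; first exact: hnorm_ge0.
have [ffL Dff] := D_algebra ana Df Df.
rewrite (Mfun_energy Qinv t_gt0 ffL _ (Q_martingale sto Df)) ?opL_dot//.
exact: L_invariant ana _ Dff.
Qed.

Lemma backward_norm f : D f -> nQ (L2class Q (Mfun_reversed f (opLhat S A f) t)) = energy f.
Proof.
move=> Df; rewrite (hnorm_Mfun_reversed Qinv Qhatinv (Qhat_reversal sto) t_gt0).
apply: sqrt_energy; first exact: hnorm_ge0.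
have [ffL Dff] := D_algebra ana Df Df.
rewrite (Mfun_energy Qhatinv t_gt0 ffL _ (Qhat_martingale sto Df)) ?opLhat_dot//.
exact: Lhat_invariant ana _ Dff.
Qed.

(** Solve the forward decomposition for the time integral; by stationarity each of the two boundary
    values has the norm of [f]. *)
Lemma hnorm_intH_opL f : D f -> nQ (intH (opL S A f)) <= 2 * nmu f + energy f.
Proof.
move=> Df; have := forward_norm Df; rewrite (MfunE Qinv t_gt0).
set m := _ - intH _ => <-.
have -> : intH (opL S A f) = (evalH Q pathY t f - evalH Q pathY 0 f) - m.
  by rewrite /m opprB addrCA subrr addr0.
apply: le_trans (ler_hnormB ipQ _ _) _; rewrite lerD2r.
apply: le_trans (ler_hnormB ipQ _ _) _.
rewrite !(hnorm_evalH (@measurable_path_at R E) tlaw) ?lexx ?(ltW t_gt0)//.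
by rewrite mulr_natl mulr2n.
Qed.

(* Adding the forward and the backward decompositions cancels the boundary terms. *)
Lemma hnorm_intH_S f : D f -> nQ (intH (S f)) <= energy f.
Proof.
move=> Df; have := forward_norm Df; have := backward_norm Df.
rewrite (MfunE Qinv t_gt0) (Mfun_reversedE Qinv t_gt0).
set m' := _ - intH _; set m := _ - intH _ => em' em.
have intHD (g h : H) : intH (g + h) = intH g + intH h.
  have := timeintH_linear (@measurable_path_at R E) t_gt0 tlaw 1 g h.
  by rewrite !scale1r.
(* The antisymmetric parts cancel as well: [opL] and [opLhat] add up to twice [S]. *)
have E2 : 2 *: intH (S f) = - (m + m').
  have -> : 2 *: intH (S f) = intH (opL S A f) + intH (opLhat S A f).
    by rewrite -intHD /opL /opLhat addrACA addNr addr0 intHD scaler_nat mulr2n.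
  exact: boundary_cancel.
clearbody m m'; have h : nQ (2 *: intH (S f)) <= nQ m + nQ m'.
  by rewrite E2 (hnormN ipQ); exact: (ler_hnormD ipQ).
by move: h; rewrite (hnormZ ipQ) em em' normr_nat; lra.
Qed.

End forward_backward.
End path_functionals.

(** * The ergodicity estimate *)

(** Used for [S] and for [G]: [x] is the energy, [a] the norm of the image, [b] the norm of the
    component off the kernel. Spectral gap and Cauchy-Schwarz together bound [b], and then
    [x <= a * b]. *)
Lemma gap_bound (R : realType) (L a b x : R) : 0 < L -> 0 <= a -> 0 <= b ->
  L * b ^+ 2 <= x -> x <= a * b -> x <= a ^+ 2 / L /\ b <= a / L.
Proof.
move=> L0 a0 b0 h1 h2.
have hb : b <= a / L.
  rewrite ler_pdivlMr//; have [->|bN0] := eqVneq b 0; first by rewrite mul0r.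
  have bgt0 : 0 < b by rewrite lt_def bN0.
  by rewrite -(ler_pM2r bgt0); nra.
split => //; apply: le_trans h2 _.
by rewrite expr2 -mulrA ler_wpM2l.
Qed.

(** * Consequences of the defining property of an orthogonal projection *)

Section orthogonal_projection.
Context (R : realType) (V : lmodType R) (dot : V -> V -> R) (ip : inner_product dot).
Context (N : set V) (P : V -> V) (PN : orth_proj dot N P).
Context (N0 : N 0) (Nlin : forall a f g, N f -> N g -> N (a *: f + g)).
Local Notation nm := (hnorm dot).

Lemma orth_projP f : N (P f). Proof. exact: (PN f).1. Qed.

Lemma orth_proj_orth f g : N g -> dot (f - P f) g = 0.
Proof. exact: (PN f).2. Qed.

(** The difference of two candidates lies in [N] and is orthogonal to [N]. As [P] is a mere function
    with this property, its linearity is derived from here. *)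
Lemma orth_proj_unique f p : N p -> (forall g, N g -> dot (f - p) g = 0) -> P f = p.
Proof.
move=> Np fp; apply/eqP; rewrite -subr_eq0; apply/eqP/(dot_eq0 ip).
have Nd : N (P f - p).
  by rewrite addrC -scaleN1r; apply: Nlin => //; exact: orth_projP.
rewrite -{1}(subrKA f (P f) (- p)) (dotDl ip) fp// addr0 -opprB (dotNl ip).
by rewrite orth_proj_orth// oppr0.
Qed.

Lemma orth_proj_id f : N f -> P f = f.
Proof. by move=> Nf; apply: orth_proj_unique => // g _; rewrite subrr (dot0l ip). Qed.

Lemma orth_proj0 f : (forall g, N g -> dot f g = 0) -> P f = 0.
Proof. by move=> fN; apply: orth_proj_unique => // g Ng; rewrite subr0 fN. Qed.

Lemma orth_proj_linear a f g : P (a *: f + g) = a *: P f + P g.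
Proof.
apply: orth_proj_unique; first by apply: Nlin; exact: orth_projP.
move=> k Nk; rewrite opprD addrACA -scalerBr (dot_linearl ip).
by rewrite !orth_proj_orth// mulr0 addr0.
Qed.

Lemma orth_projB f g : P (f - g) = P f - P g.
Proof. by rewrite -[in LHS]scaleN1r addrC orth_proj_linear scaleN1r addrC. Qed.

Lemma orth_proj_dotl f g : N g -> dot (P f) g = dot f g.
Proof.
by move=> Ng; apply/eqP; rewrite eq_sym -subr_eq0 -(dotBl ip) orth_proj_orth.
Qed.

Lemma orth_proj_dotr f g : N g -> dot g (P f) = dot g f.
Proof. by move=> Ng; rewrite !(dotC ip g) orth_proj_dotl. Qed.

Lemma orth_proj_pythagoras f : nm f ^+ 2 = nm (P f) ^+ 2 + nm (f - P f) ^+ 2.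
Proof.
have := orth_proj_orth f (orth_projP f).
rewrite !(sqr_hnorm ip) !(dotE ip) (dotC ip f (P f)); lra.
Qed.

Lemma hnorm_orth_proj f : nm (P f) <= nm f.
Proof.
rewrite -ler_sqr ?nnegrE ?hnorm_ge0// [leRHS]orth_proj_pythagoras lerDl; exact: sqr_ge0.
Qed.

Lemma hnorm_orth_projC f : nm (f - P f) <= nm f.
Proof.
rewrite -ler_sqr ?nnegrE ?hnorm_ge0// [leRHS]orth_proj_pythagoras lerDr; exact: sqr_ge0.
Qed.

End orthogonal_projection.

(** * The estimate in an abstract Hilbert space *)

Section ergodicity_bound.
Context (R : realType) (V : lmodType R) (dot : V -> V -> R) (ip : inner_product dot).
Context (Vcomplete : hcomplete dot).
Context (D : set V) (S A P : V -> V) (one : V) (Lm LM c1 c2 t : R).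

Local Notation nm := (hnorm dot).
Local Notation L := (fun f => S f - A f).
Local Notation GS := (closure_graph dot setT (opgraph D S)).
Local Notation GA := (closure_graph dot setT (opgraph D A)).
Local Notation GL := (closure_graph dot setT (opgraph D L)).
Local Notation Sbar := (closure_op dot setT D S).
Local Notation Abar := (closure_op dot setT D A).
Local Notation Lbar := (closure_op dot setT D L).
Local Notation domS := (closure_dom dot setT D S).
Local Notation domA := (closure_dom dot setT D A).
Local Notation domL := (closure_dom dot setT D L).
Local Notation DP := (P @` D).
Local Notation HP := (range P).
Local Notation G := (fun f => P (Abar (Abar (P f)))).
Local Notation GG := (closure_graph dot HP (opgraph DP G)).
Local Notation ker := (closure_ker dot setT D S).

Context (D0 : D 0) (Dlin : forall a f g, D f -> D g -> D (a *: f + g)).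
Context (Slin : linear_on D S) (Ssym : symmetric_on dot D S).
Context (Sclos : closable dot setT D S).
Context (Alin : linear_on D A) (Aanti : antisymmetric_on dot D A).
Context (Aclos : closable dot setT D A).
Context (PN : orth_proj dot ker P).
Context (one1 : nm one = 1) (t_gt0 : 0 < t) (Lm0 : 0 < Lm) (LM0 : 0 < LM).
Context (c10 : 0 <= c1) (c20 : 0 <= c2).
Context (Sess : ess_selfadjoint dot setT D S).
Context (Sgap : forall f, D f -> Lm * nm (f - P f) ^+ 2 <= - dot (S f) f).
Context (DPdomA : DP `<=` domA) (ADPdom : Abar @` DP `<=` domA `&` domS `&` domL).
Context (LE : forall g, (Abar @` DP) g -> Lbar g = Sbar g - Abar g).
Context (LAP_le : forall f, DP f -> nm (Lbar (Abar (P f))) <= c1 * nm (G f) + c2 * nm f).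
Context (Gess : ess_selfadjoint dot HP DP G).
Context (Ggap : forall f, DP f -> LM * nm (f - dot f one *: one) ^+ 2 <= - dot (G f) f).
Context (HPone : HP one) (Gone : GG (one, 0)).

Let T0 : [set: V] 0. Proof. by []. Qed.
Let Tlin (a : R) (f g : V) : [set: V] f -> [set: V] g -> [set: V] (a *: f + g).
Proof. by []. Qed.

Let kerP f : ker f <-> GS (f, 0).
Proof.
split=> [[fdom f0]|f0]; first by rewrite -f0; exact: closure_opP.
split; first by exists 0.
exact: (closure_opE ip D0 Dlin T0 Tlin Slin Sclos).
Qed.

Let ker0 : ker 0.
Proof.
apply/kerP/(closure_graphP ip); split => //; exists (fun=> 0); split=> //.
- exact: (hcvg_cst ip).
- by rewrite (linear_on0 D0 Slin); exact: (hcvg_cst ip).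
Qed.

Let kerlin a f g : ker f -> ker g -> ker (a *: f + g).
Proof.
move=> /kerP kf /kerP kg; apply/kerP.
have := closure_graph_linear ip Dlin Tlin Slin a kf kg.
by rewrite scaler0 addr0.
Qed.

Let ker_closed (u : nat -> V) f : (forall n, ker (u n)) -> hcvg dot u f -> ker f.
Proof.
move=> ku uf; apply/kerP; exact: (@closure_graph_closed _ _ _ ip setT D S u (fun=> 0) f 0 I I
  (fun n => (kerP (u n)).1 (ku n)) uf (hcvg_cst ip 0)).
Qed.

Let HP_ker f : HP f <-> ker f.
Proof.
split=> [[g _ <-]|kf]; first exact: (orth_projP PN).
by exists f => //; exact: (orth_proj_id ip PN).
Qed.

Let DP_ker f : DP f -> ker f.
Proof. by move=> [g _ <-]; exact: (orth_projP PN). Qed.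

Let DPlin a f g : DP f -> DP g -> DP (a *: f + g).
Proof.
move=> [f' Df <-] [g' Dg <-]; exists (a *: f' + g'); first exact: Dlin.
exact: (orth_proj_linear ip PN).
Qed.

Let DP0 : DP 0.
Proof. by exists 0 => //; exact: (orth_proj_id ip PN). Qed.

(** Symmetry moves [S] onto the approximants of [k], whose images tend to 0. *)
Let GS_orth_ker f g k : GS (f, g) -> ker k -> dot g k = 0.
Proof.
move=> /(closure_graphP ip)[_ _ [u [Du _ Su]]].
move=> /kerP/(closure_graphP ip)[_ _ [v [Dv vk Sv]]].
apply: (cvg_dot_eq0 ip Su) => n.
rewrite -(dot0r ip (u n)).
apply: (cvg_eq (cvg_dot ip (hcvg_cst ip (S (u n))) vk)
  (cvg_dot ip (hcvg_cst ip (u n)) Sv)) => m.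
exact: Ssym.
Qed.

Let dot_S_gap f : D f ->
  - dot (S f) f <= nm (S f) ^+ 2 / Lm.
Proof.
move=> Df; apply: (gap_bound Lm0 _ _ (Sgap Df) _).1; try exact: hnorm_ge0.
(* Hence the energy equals [dot (S f) (P f - f)], to which Cauchy-Schwarz is applied. *)
have SP : dot (S f) (P f) = 0.
  apply: (GS_orth_ker (f := f)); last exact: (orth_projP PN).
  exact: (closure_graph_op ip).
have := dot_le_hnorm ip (S f) (P f - f).
by rewrite (dotBr ip) SP sub0r (hnormC ip).
Qed.

(* An abstract version of the [L^2(Q)] norm of the time integral over [0, t]. *)
Context (N : V -> R).
Context (ND : forall f g, N (f + g) <= N f + N g) (NN : forall f, N (- f) = N f).
Context (N_le : forall f, N f <= t * nm f).
Context (NS : forall f, D f -> N (S f) <= Num.sqrt (2 * t * - dot (S f) f)).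
Context (NL : forall f, D f ->
  N (L f) <= 2 * nm f + Num.sqrt (2 * t * - dot (S f) f)).

(** [N f] exceeds [N (u n)] by at most [t * nm (f - u n)], so bounds along a sequence survive in the
    limit. *)
Let N_lim (u : nat -> V) f (b : nat -> R) c : hcvg dot u f ->
  (forall n, N (u n) <= b n) -> b n @[n --> \oo] --> c -> N f <= c.
Proof.
move=> uf ub bc.
have h : t * nm (u n - f) + b n @[n --> \oo] --> t * 0 + c.
  by apply: cvgD => //; apply: cvgM => //; exact: cvg_cst.
rewrite mulr0 add0r in h.
apply: (cvg_ler (cvg_cst (N f)) h) => n.
have := ND (f - u n) (u n); rewrite subrK => /le_trans; apply.
by rewrite lerD// (hnormC ip).
Qed.

Let SDlin : forall a f g, (S @` D) f -> (S @` D) g -> (S @` D) (a *: f + g).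
Proof.
move=> a _ _ [f Df <-] [g Dg <-]; exists (a *: f + g); first exact: Dlin.
exact: Slin.
Qed.

Lemma N_orthogonal g : (forall k, ker k -> dot g k = 0) ->
  N g <= Num.sqrt (2 * t / Lm) * nm g.
Proof.
move=> gker.
have SD0 : (S @` D) 0 by exists 0 => //; exact: (linear_on0 D0 Slin).
have [p [/(exists_hcvg ip)[w Dw wp] pS]] :=
  orthogonal_decomposition ip Vcomplete SD0 SDlin g.
have /choice[u Hu] : forall n, exists u, D u /\ S u = w n.
  by move=> n; have [u Du Su] := Dw n; exists u.
(* [p] is the projection of [g] onto the closure of the range of [S]. The remainder lies in the
   kernel, while [g] and [p] are both orthogonal to the kernel; so it vanishes. *)
have kk : ker (g - p).
  apply/kerP; apply: (ess_selfadjoint_orthogonal_range ip) => //.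
  by move=> f Df; rewrite (dotC ip) pS//; exists f.
have pker k : ker k -> dot p k = 0.
  move=> kerk; apply: (cvg_dot_eq0 ip wp) => n; have [Du <-] := Hu n.
  by apply: (GS_orth_ker (f := u n)) kerk; exact: (closure_graph_op ip).
have gp : g = p.
  apply/eqP; rewrite -subr_eq0; apply/eqP/(dot_eq0 ip).
  by rewrite (dotBl ip) gker// pker// subrr.
rewrite gp.
apply: (N_lim wp (b := fun n => Num.sqrt (2 * t / Lm) * nm (w n))).
  move=> n; have [Du <-] := Hu n; apply: le_trans (NS Du) _.
  rewrite -[X in _ <= _ * X]ger0_norm ?hnorm_ge0// -sqrtr_sqr -sqrtrM; last first.
    by rewrite divr_ge0 ?mulr_ge0// ltW.
  apply: ler_wsqrtr; rewrite -!mulrA ler_wpM2l// ler_wpM2l ?(ltW t_gt0)//.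
  by rewrite mulrC; exact: dot_S_gap.
by apply: cvgM; [exact: cvg_cst|exact: (cvg_hnorm ip)].
Qed.

Let A_dot0 f : D f -> dot (A f) f = 0.
Proof. by move=> Df; have := Aanti Df Df; rewrite (dotC ip f) => h; lra. Qed.

(** The energy is replaced by [nm (L w) * nm w] before the limit is taken: along a sequence
    approximating a point of the closure of L, the images under [S] need not converge. *)
Lemma N_generator u v : GL (u, v) ->
  N v <= 2 * nm u + Num.sqrt (2 * t * (nm v * nm u)).
Proof.
move=> /(closure_graphP ip)[_ _ [w [Dw wu Lw]]].
apply: (N_lim Lw (b := fun n => 2 * nm (w n) + Num.sqrt (2 * t * (nm (L (w n)) * nm (w n))))).
  move=> n; apply: le_trans (NL (Dw n)) _; rewrite lerD2l; apply: ler_wsqrtr.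
  rewrite ler_wpM2l ?mulr_ge0 ?(ltW t_gt0)//.
  have -> : dot (S (w n)) (w n) = dot (L (w n)) (w n) by rewrite (dotBl ip) A_dot0 ?subr0.
  by rewrite -(dotNl ip) -(hnormN ip (L _)) (dot_le_hnorm ip).
apply: cvgD.
  by apply: cvgM; [exact: cvg_cst|exact: (cvg_hnorm ip)].
have h : 2 * t * (nm (L (w n)) * nm (w n)) @[n --> \oo] --> 2 * t * (nm v * nm u).
  by apply: cvgM; [exact: cvg_cst|apply: cvgM; exact: (cvg_hnorm ip)].
exact: (cvg_comp _ _ h (@sqrt_continuous R _)).
Qed.

Let GA_antisymmetric f f' g g' : GA (f, f') -> GA (g, g') -> dot f' g = - dot f g'.
Proof.
move=> /(closure_graphP ip)[_ _ [u [Du uf Au]]] /(closure_graphP ip)[_ _ [v [Dv vg Av]]].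
apply: (cvg_eq (cvg_dot ip Au vg) (cvgN (cvg_dot ip uf Av))) => n.
exact: Aanti.
Qed.

Let DP_id h : DP h -> P h = h.
Proof. by move=> /DP_ker; exact: (orth_proj_id ip PN). Qed.

Let Abar_linear a f g : domA f -> domA g -> Abar (a *: f + g) = a *: Abar f + Abar g.
Proof.
move=> /closure_opP fA /closure_opP gA.
apply: (closure_opE ip D0 Dlin T0 Tlin Alin Aclos).
exact: (closure_graph_linear ip Dlin Tlin Alin a fA gA).
Qed.

Let ADP h : DP h -> [/\ domA (Abar h), domS (Abar h) & domL (Abar h)].
Proof.
by move=> Dh; have [[]] := ADPdom (ex_intro2 _ _ h Dh erefl).
Qed.

Let Glin : linear_on DP G.
Proof.
move=> a f g Df Dg /=; rewrite (DP_id (DPlin a Df Dg)) (DP_id Df) (DP_id Dg).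
rewrite Abar_linear//; [|exact: DPdomA|exact: DPdomA].
have [fA _ _] := ADP Df; have [gA _ _] := ADP Dg.
by rewrite Abar_linear// (orth_proj_linear ip PN).
Qed.

(** The closure of [A] is antisymmetric, and [P] may be inserted because [h] is in its range. *)
Lemma hnorm_Abar h : DP h -> nm (Abar h) ^+ 2 = - dot (G h) h.
Proof.
move=> Dh; have [hA _ _] := ADP Dh; rewrite (sqr_hnorm ip) (DP_id Dh).
rewrite (GA_antisymmetric (closure_opP (DPdomA Dh)) (closure_opP hA)).
by rewrite (dotC ip (P _)) (orth_proj_dotr ip PN)//; exact: DP_ker.
Qed.

Lemma P_Lbar h : DP h -> P (Lbar (Abar h)) = - G h.
Proof.
move=> Dh; have [_ hS _] := ADP Dh; rewrite LE; last by exists h.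
rewrite /= (DP_id Dh) (orth_projB ip PN)// [P (Sbar _)](orth_proj0 ip PN) ?sub0r// => k.
exact: (GS_orth_ker (closure_opP hS)).
Qed.

Lemma N_G h v : DP h -> v = Lbar (Abar h) ->
  N (G h) <= 2 * nm (Abar h) + Num.sqrt (2 * t * (nm v * nm (Abar h)))
    + Num.sqrt (2 * t / Lm) * nm v.
Proof.
move=> Dh vE; have [_ _ hL] := ADP Dh.
(* [P L A h = - G h], as the range of [S] is orthogonal to its kernel *)
have -> : G h = - v + (v - P v) by rewrite {3}vE P_Lbar// opprK addrA addNr add0r.
apply: le_trans (ND _ _) _; apply: lerD.
  by rewrite NN; apply: N_generator; rewrite vE; exact: closure_opP hL.
apply: le_trans (N_orthogonal (fun k => @orth_proj_orth _ _ _ _ _ PN v k)) _.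
by rewrite ler_wpM2l ?sqrtr_ge0// (hnorm_orth_projC ip PN).
Qed.

Let HP_G h : HP (G h). Proof. by exists (Abar (Abar (P h))). Qed.

(** The closure of [G] is its own adjoint and sends [one] to 0. *)
Let dot_G_one h : DP h -> dot (G h) one = 0.
Proof.
move=> Dh; have [_ _ GGE] := Gess.
have : GG (h, G h).
  by apply: (closure_graph_op ip) => //; apply/HP_ker; exact: DP_ker.
by rewrite GGE => -[_ _ /(_ _ Gone)] /=; rewrite (dot0l ip) (dotC ip) => <-.
Qed.

Let dot_one_le f : `|dot f one| <= nm f.
Proof. by have := normr_dot_le ip f one; rewrite one1 mulr1. Qed.

(** Since [G h] is orthogonal to [one], [h] may be replaced by its centered version in the energy,
    and [gap_bound] applies. *)
Lemma G_gap h : DP h ->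
  - dot (G h) h <= nm (G h) ^+ 2 / LM /\ nm (h - dot h one *: one) <= nm (G h) / LM.
Proof.
move=> Dh; apply: (gap_bound LM0) (Ggap Dh) _; try exact: hnorm_ge0.
have := dot_le_hnorm ip (- G h) (h - dot h one *: one).
by rewrite (hnormN ip) (dotNl ip) (dotBr ip) (dotZr ip) dot_G_one// mulr0 subr0.
Qed.

Let GDlin a f g : (G @` DP) f -> (G @` DP) g -> (G @` DP) (a *: f + g).
Proof.
move=> [f' Df <-] [g' Dg <-]; exists (a *: f' + g'); first exact: DPlin.
exact: Glin.
Qed.

(** The gap of [G] passes to the closure: along approximants of [k] the energy tends to 0, hence so
    do their centered versions, whose limit is [k]. *)
Let kerGG_const k : GG (k, 0) -> dot k one = 0 -> k = 0.
Proof.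
move=> /(closure_graphP ip)[_ _ [u [Du uk Gu]]] k1.
have c1' := cvg_dot ip Gu uk; rewrite (dot0l ip) in c1'.
have c : hcvg dot (fun n => u n - dot (u n) one *: one) k.
  apply: (hcvg_le (c := fun n => nm (u n - k) + nm (u n - k))) => [n|].
    rewrite addrAC; apply: le_trans (ler_hnormB ip _ _) _; rewrite lerD2l.
    rewrite (hnormZ ip) one1 mulr1.
    have -> : dot (u n) one = dot (u n - k) one by rewrite (dotBl ip) k1 subr0.
    exact: dot_one_le.
  by rewrite -[X in _ --> X]addr0; apply: cvgD.
have c2' : LM * (nm (u n - dot (u n) one *: one) * nm (u n - dot (u n) one *: one))
    @[n --> \oo] --> LM * (nm k * nm k).
  apply: cvgM; first exact: cvg_cst.
  by apply: cvgM; exact: (cvg_hnorm ip).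
have h : LM * (nm k * nm k) <= - 0.
  by apply: (cvg_ler c2' (cvgN c1')) => n; rewrite -expr2; exact: Ggap (Du n).
apply: (hnorm_eq0 ip); apply/eqP; rewrite -sqrf_eq0 eq_le sqr_ge0 andbT.
by move: h; rewrite oppr0 pmulr_rle0// -expr2.
Qed.

(** The remainder of [f] off the closed range of [G] is centered and in the kernel of the closure,
    hence 0. A preimage may have any mean; the mean is made small by subtracting a multiple of some
    [k] close to [one] with [G k] close to 0. *)
Lemma G_dense f e : ker f -> dot f one = 0 -> 0 < e ->
  exists h, [/\ DP h, nm (f - G h) < e & `|dot h one| < e].
Proof.
move=> kf f1 e0.
have GD0 : (G @` DP) 0 by exists 0 => //; exact: (linear_on0 DP0 Glin).
have [p [/(exists_hcvg ip)[w Dw wp] pG]] := orthogonal_decomposition ip Vcomplete GD0 GDlin f.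
have kp : ker p.
  apply: ker_closed wp => n; have [h _ <-] := Dw n; exact: (orth_projP PN).
have kfp : ker (f - p) by rewrite -scaleN1r addrC; exact: kerlin.
have p1 : dot p one = 0.
  by apply: (cvg_dot_eq0 ip wp) => n; have [h Dh <-] := Dw n; exact: dot_G_one.
have fp : f = p.
  apply/eqP; rewrite -subr_eq0; apply/eqP/kerGG_const; last by rewrite (dotBl ip) f1 p1 subrr.
  apply: (ess_selfadjoint_orthogonal_range ip) => //.
  - by apply/HP_ker.
  - by apply/HP_ker.
  - by move=> h Dh; rewrite (dotC ip) pG//; exists h.
have e20 : 0 < e / 2 by rewrite divr_gt0.
have [n wn] : exists n, nm (w n - p) < e / 2.
  by have /hcvgP/(_ _ e20)[n _ H] := wp; exists n; apply: H => /=.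
have [h0 Dh0 Gh0] := Dw n.
(* [d] is the precision at which [one] is approximated, chosen so that an error [d] multiplied by
   the mean [a] stays below e / 2; the summand 1 covers [a = 0]. *)
pose a := dot h0 one; pose d := e / 2 / (`|a| + 1).
have a10 : 0 < `|a| + 1 by rewrite ltr_pwDr.
have d0 : 0 < d by rewrite divr_gt0.
have ad : `|a| * d < e / 2.
  by rewrite /d mulrCA gtr_pMr// ltr_pdivrMr// mul1r ltrDl.
have [_ _ /(_ _ d0)[_ [k Dk <-]] /= [k1 Gk]] := Gone.
exists ((- a) *: k + h0); split.
- exact: DPlin.
- rewrite Glin// Gh0 fp.
  have -> : p - ((- a) *: G k + w n) = (p - w n) + a *: G k.
    by rewrite scaleNr opprD opprK addrCA addrC.
  apply: le_lt_trans (ler_hnormD ip _ _) _; rewrite (splitr e).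
  apply: ltrD; first by rewrite (hnormC ip).
  rewrite (hnormZ ip); apply: le_lt_trans ad; rewrite ler_wpM2l//.
  by rewrite -(hnormN ip) -(sub0r (G k)) ltW.
- rewrite (dot_linearl ip) -/a.
  have -> : - a * dot k one + a = a * dot (one - k) one.
    by rewrite (dotBl ip) -(sqr_hnorm ip) one1 expr1n; ring.
  rewrite normrM; apply: (@lt_trans _ _ (e / 2)); last by lra.
  apply: le_lt_trans ad; rewrite ler_wpM2l//; apply: le_trans (dot_one_le _) _.
  exact: ltW.
Qed.

Let hnorm_Abar_le h : DP h -> nm (Abar h) <= nm (G h) / Num.sqrt LM.
Proof.
move=> Dh; rewrite -ler_sqr ?nnegrE ?hnorm_ge0 ?divr_ge0 ?hnorm_ge0 ?sqrtr_ge0//.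
rewrite hnorm_Abar// expr_div_n (sqr_sqrtr (ltW LM0)).
exact: (G_gap Dh).1.
Qed.

Let hnorm_le_G h : DP h -> nm h <= nm (G h) / LM + `|dot h one|.
Proof.
move=> Dh; rewrite -{1}(subrK (dot h one *: one) h) (le_trans (ler_hnormD ip _ _))//.
by apply: lerD; [exact: (G_gap Dh).2|rewrite (hnormZ ip) one1 mulr1].
Qed.

(** The bound of [N_G] as a function of a = |G h| and of the absolute mean beta of [h], with |A h|
    <= a / sqrt LM and |h| <= a / LM + beta. Being continuous, it can be taken to the limit where
    beta is 0. *)
Let b a (beta : R) := 2 * (a / Num.sqrt LM)
  + Num.sqrt (2 * t * ((c1 * a + c2 * (a / LM + beta)) * (a / Num.sqrt LM)))
  + Num.sqrt (2 * t / Lm) * (c1 * a + c2 * (a / LM + beta)).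

Let N_G_le h : DP h -> N (G h) <= b (nm (G h)) `|dot h one|.
Proof.
move=> Dh; have hA := hnorm_Abar_le Dh.
have hv : nm (Lbar (Abar h)) <= c1 * nm (G h) + c2 * (nm (G h) / LM + `|dot h one|).
  have := LAP_le Dh; have -> : Lbar (Abar (P h)) = Lbar (Abar h) by rewrite (DP_id Dh).
  move=> /le_trans; apply; apply: lerD => //; apply: ler_wpM2l => //.
  exact: hnorm_le_G.
apply: le_trans (N_G Dh erefl) _; rewrite /b; apply: lerD; first apply: lerD.
- by rewrite ler_wpM2l.
- apply: ler_wsqrtr; rewrite ler_wpM2l ?mulr_ge0 ?(ltW t_gt0)//.
  by apply: ler_pM; rewrite ?hnorm_ge0.
- by rewrite ler_wpM2l ?sqrtr_ge0.
Qed.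

Let N_ker_le f : ker f -> dot f one = 0 -> N f <= b (nm f) 0.
Proof.
move=> kf f1.
have /choice[h Hh] : forall n : nat, exists h,
    [/\ DP h, nm (f - G h) < n.+1%:R^-1 & `|dot h one| < n.+1%:R^-1].
  by move=> n; apply: G_dense => //; rewrite invr_gt0.
have Gf : hcvg dot (fun n => G (h n)) f.
  apply: (hcvg_le (c := fun n => n.+1%:R^-1)) => [n|]; last exact: cvg_harmonic.
  by rewrite (hnormC ip) ltW//; case: (Hh n).
have an := cvg_hnorm ip Gf.
have betan : `|dot (h n) one| @[n --> \oo] --> (0 : R).
  apply: squeeze_cvgr (@cvg_harmonic R); last exact: cvg_cst.
  by apply: nearW => n; rewrite normr_ge0 ltW//; case: (Hh n).
have cM (k : R) (u : nat -> R) (l : R) : u n @[n --> \oo] --> l ->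
    k * u n @[n --> \oo] --> k * l.
  by move=> ul; apply: cvgM => //; exact: cvg_cst.
have cMr (k : R) (u : nat -> R) (l : R) : u n @[n --> \oo] --> l ->
    u n * k @[n --> \oo] --> l * k.
  by move=> ul; apply: cvgM => //; exact: cvg_cst.
have cv : c1 * nm (G (h n)) + c2 * (nm (G (h n)) / LM + `|dot (h n) one|)
    @[n --> \oo] --> c1 * nm f + c2 * (nm f / LM + 0).
  by apply: cvgD; [exact: cM|apply: cM; apply: cvgD => //; exact: cMr].
apply: (N_lim Gf (fun n => N_G_le _)) => [n|]; first by case: (Hh n).
apply: cvgD; last exact: cM.
apply: cvgD; first by apply: cM; exact: cMr.
have hs : 2 * t * ((c1 * nm (G (h n)) + c2 * (nm (G (h n)) / LM + `|dot (h n) one|))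
      * (nm (G (h n)) / Num.sqrt LM)) @[n --> \oo]
    --> 2 * t * ((c1 * nm f + c2 * (nm f / LM + 0)) * (nm f / Num.sqrt LM)).
  by apply: cM; apply: cvgM => //; exact: cMr.
exact: (cvg_comp _ _ hs (@sqrt_continuous R _)).
Qed.

Lemma N_le_kappa f : dot f one = 0 ->
  N f <= Num.sqrt 2 * (kappa1 LM + Num.sqrt t * kappa2 Lm LM c1 c2) * nm f.
Proof.
move=> f1.
have Pf1 : dot (P f) one = 0.
  by rewrite (orth_proj_dotl ip PN)//; apply/HP_ker.
have := ND (P f) (f - P f); rewrite subrKC => /le_trans; apply.
have h1 := N_ker_le (orth_projP PN f) Pf1.
have h2 := N_orthogonal (fun k => @orth_proj_orth _ _ _ _ _ PN f k).
have t0 := ltW t_gt0; have Lm0' := ltW Lm0; have LM0' := ltW LM0.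
have sLM : 0 < Num.sqrt LM by rewrite sqrtr_gt0.
have sLm : 0 < Num.sqrt Lm by rewrite sqrtr_gt0.
have s2E : Num.sqrt (2 * t / Lm) = Num.sqrt 2 * Num.sqrt t / Num.sqrt Lm.
  by rewrite !sqrtrM ?mulr_ge0// sqrtrV.
have ss2 : Num.sqrt 2 * Num.sqrt 2 = 2 :> R by rewrite -expr2 sqr_sqrtr.
(* Without the mean, [b] is homogeneous of degree 1 in [a]: the factor [a ^+ 2] leaves the square
   root. The boundary coefficient 2 is written as the square of [Num.sqrt 2] to reveal [kappa1]. *)
have bE a : 0 <= a -> b a 0 = (Num.sqrt 2 * (kappa1 LM + Num.sqrt t *
    ((c1 + c2 / LM) / Num.sqrt Lm + Num.sqrt (c1 / Num.sqrt LM + c2 / (LM * Num.sqrt LM))))) * a.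
  move=> a0; rewrite /b s2E.
  have -> : 2 * t * ((c1 * a + c2 * (a / LM + 0)) * (a / Num.sqrt LM)) =
      2 * t * (c1 / Num.sqrt LM + c2 / (LM * Num.sqrt LM)) * a ^+ 2.
    by field; rewrite !gt_eqF.
  rewrite sqrtrM; last by rewrite mulr_ge0 ?mulr_ge0// addr_ge0// divr_ge0 ?mulr_ge0// ltW.
  rewrite sqrtr_sqr (ger0_norm a0) !sqrtrM ?mulr_ge0// /kappa1 -[X in X * (a / _)]ss2.
  by field; rewrite !gt_eqF.
have nf0 := hnorm_ge0 dot f.
(* The summand [Num.sqrt (2 * t / Lm) * nm f], due to the part off the kernel, turns [c1] into
   [c1 + 1] in [kappa2]. *)
apply: (@le_trans _ _ (b (nm f) 0 + Num.sqrt (2 * t / Lm) * nm f)).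
  apply: lerD.
    apply: (le_trans h1); rewrite !bE ?hnorm_ge0//; apply: ler_wpM2l.
      rewrite mulr_ge0 ?sqrtr_ge0// addr_ge0//.
        by rewrite /kappa1 divr_ge0 ?sqrtr_ge0.
      rewrite mulr_ge0 ?sqrtr_ge0// addr_ge0 ?sqrtr_ge0//.
      by rewrite divr_ge0 ?sqrtr_ge0// addr_ge0// divr_ge0.
    exact: (hnorm_orth_proj ip PN).
  apply: (le_trans h2); rewrite ler_wpM2l ?sqrtr_ge0//.
  exact: (hnorm_orth_projC ip PN).
rewrite bE// s2E /kappa2 le_eqVlt; apply/orP; left; apply/eqP.
by field; rewrite !gt_eqF.
Qed.

End ergodicity_bound.

(** * Back to L^2 and to the paths *)

Lemma hnorm_timeintH_le_kappa (R : realType) (E : pmetricType R)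
    (mu : probability (borel E) R)
    (D : set (LspaceType2 mu)) (S A P : LspaceType2 mu -> LspaceType2 mu)
    (Q Qhat : probability (paths E) R) (Lm LM c1 c2 t : R) :
  analytic_setting D S A P -> stochastic_setting D S A Q Qhat ->
  0 < Lm -> condition_E1 D S P Lm ->
  0 <= c1 -> 0 <= c2 -> condition_E2 D S A P c1 c2 ->
  0 < LM -> condition_E3 D A P LM -> 0 < t ->
  forall f : LspaceType2 mu, L2dot f (L2one mu) = 0 ->
  hnorm (@L2dot _ _ R Q) (timeintH Q (@path_at R E) t f) <=
  Num.sqrt 2 * (kappa1 LM + Num.sqrt t * kappa2 Lm LM c1 c2) * hnorm (@L2dot _ _ R mu) f.
Proof.
move=> ana sto Lm0 [Sess Sgap] c10 c20 [[DPdomA ADPdom LE] LAP_le] LM0.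
move=> [Gess Ggap HPone Gdom G0] t_gt0 f f1.
have [/set_mem D0 Dl] := D_subspace ana.
have Dlin a g h : D g -> D h -> D (a *: g + h).
  by move=> Dg Dh; apply/set_mem; apply: Dl; exact: mem_set.
have tlaw := path_at_law (Q_invariant sto) (t := t).
have mY := @measurable_path_at R E.
have intlin := timeintH_linear mY t_gt0 tlaw.
have intD (g h : LspaceType2 mu) : timeintH Q (@path_at R E) t (g + h) =
    timeintH Q (@path_at R E) t g + timeintH Q (@path_at R E) t h.
  by have := intlin 1 g h; rewrite !scale1r.
have int0 : timeintH Q (@path_at R E) t (0 : LspaceType2 mu) = 0.
  by have := intlin (-1) 0 0; rewrite !scaleN1r oppr0 addr0 addNr.
have intN (g : LspaceType2 mu) :
    timeintH Q (@path_at R E) t (- g) = - timeintH Q (@path_at R E) t g.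
  by apply/eqP; rewrite -addr_eq0 -intD addNr int0.
(* [closure_op] has default value 0, so it is membership of the constant in the closure domain that
   turns the value 0 into a point of the graph. *)
have Gone : closure_graph (@L2dot _ _ R mu) (H_P P)
    (opgraph (D_P D P) (opG D A P)) (L2one mu, 0).
  by rewrite -G0; exact: closure_opP.
pose N (g : LspaceType2 mu) := hnorm (@L2dot _ _ R Q) (timeintH Q (@path_at R E) t g).
have ND g h : N (g + h) <= N g + N h.
  by rewrite /N intD; exact: (ler_hnormD (L2dot_inner_product Q)).
have NN g : N (- g) = N g by rewrite /N intN (hnormN (L2dot_inner_product Q)).
have N_le g : N g <= t * hnorm (@L2dot _ _ R mu) g by exact: (hnorm_timeintH mY t_gt0 tlaw).
have NS g : D g -> N (S g) <= Num.sqrt (2 * t * - L2dot (S g) g).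
  exact: (hnorm_intH_S ana sto).
have NL g : D g -> N (S g - A g) <= 2 * hnorm (@L2dot _ _ R mu) g +
    Num.sqrt (2 * t * - L2dot (S g) g).
  exact: (hnorm_intH_opL ana sto).
exact: (@N_le_kappa R (LspaceType2 mu : lmodType R) (@L2dot _ _ R mu)
  (L2dot_inner_product mu) (@L2_hcomplete _ _ _ mu) D S A P (L2one mu) Lm LM c1 c2 t
  D0 Dlin (S_linear ana) (S_symmetric ana) (S_closable ana) (A_linear ana)
  (A_antisymmetric ana) (A_closable ana) (P_projection ana) (hnorm_cst1 mu) t_gt0 Lm0 LM0 c10 c20
  Sess Sgap DPdomA ADPdom LE LAP_le Gess Ggap HPone Gone N ND NN N_le NS NL f f1).
Qed.

Theorem theorem2p5 (R : realType) (E : pmetricType R)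
    (mu : probability (borel E) R)
    (D : set (LspaceType2 mu)) (S A P : LspaceType2 mu -> LspaceType2 mu)
    (Q Qhat : probability (paths E) R) (Lm LM c1 c2 : R) :
  separable E ->
  analytic_setting D S A P ->
  stochastic_setting D S A Q Qhat ->
  0 < Lm -> condition_E1 D S P Lm ->
  0 <= c1 -> 0 <= c2 -> condition_E2 D S A P c1 c2 ->
  0 < LM -> condition_E3 D A P LM ->
  forall f : borel E -> R, f \in Lfun mu 2%:E ->
  forall t : R, 0 < t ->
  ('N[Q]_2%:E[EFin \o (fun w =>
       t^-1 * (\int[lebesgue_measure]_(s in `[0, t]) f (X s w))
       - \int[mu]_x f x)%R]
   <= (Num.sqrt 2 * (t^-1 * kappa1 LM
                     + (Num.sqrt t)^-1 * kappa2 Lm LM c1 c2))%R%:E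
      * 'N[Q]_2%:E[EFin \o (fun w => f (X 0 w) - \int[mu]_x f x)%R])%E.
Proof.
move=> _ ana sto Lm0 cE1 c10 c20 cE2 LM0 cE3 f fL t t_gt0.
set m := \int[mu]_x f x.
pose g (x : borel E) := f x - m.
have gL : g \in Lfun mu 2%:E by apply: Lfun2B => //; exact: Lfun2_cst.
have fi := Lfun2_integrable fL.
have tlaw := path_at_law (Q_invariant sto) (t := t).
have mY := @measurable_path_at R E.
have zt : 0 <= (0 : R) <= t by rewrite lexx ltW.
have g1 : L2dot (L2class mu g) (L2one mu) = 0.
  rewrite L2dot_class ?Lfun2_cst//; under eq_Rintegral do rewrite mulr1.
  rewrite /g RintegralB//; last exact: (Lfun2_integrable (Lfun2_cst mu m)).
  have muT : fine (mu setT) = 1 by rewrite probability_setT.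
  by rewrite Rintegral_cst// muT mulr1 subrr.
have main := hnorm_timeintH_le_kappa ana sto Lm0 cE1 c10 c20 cE2 LM0 cE3 t_gt0 g1.
rewrite (timeintHE mY t_gt0 tlaw gL) in main.
have gTL : timeint (@path_at R E) t g \in Lfun Q 2%:E by exact: (Lfun_timeint mY t_gt0 tlaw).
have fTL : timeint (@path_at R E) t f \in Lfun Q 2%:E by exact: (Lfun_timeint mY t_gt0 tlaw).
have avgL : (fun w => t^-1 * timeint (@path_at R E) t f w - m) \in Lfun Q 2%:E.
  by apply: Lfun2_lin => //; exact: Lfun2_cst.
(* Centering commutes with the time average only on the paths along which [f] is integrable, hence
   an equality of classes. *)
have avg_ae : L2class Q (fun w => t^-1 * timeint (@path_at R E) t f w - m) =
    t^-1 *: L2class Q (timeint (@path_at R E) t g).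
  rewrite -[RHS]addr0 -[X in _ + X](_ : L2class Q (fun=> 0) = _)//.
  rewrite -L2class_linear//; last exact: Lfun2_0.
  apply: eq_L2class => //; first by apply: Lfun2_lin => //; exact: Lfun2_0.
  have := ae_integrable_path mY t_gt0 tlaw fi; apply: filterS => w fw _.
  rewrite /timeint RintegralB//; last first.
    apply: measurable_bounded_integrable.
    - exact: measurable_itv.
    - by rewrite [X in (X < _)%E](leb_itv t_gt0) ltry.
    - exact: measurable_cst.
    - exact: bounded_cst.
  by rewrite Rintegral_cst// [X in fine X](leb_itv t_gt0) /=; field; exact: lt0r_neq0.
have -> : (fun w => t^-1 * (\int[lebesgue_measure]_(s in `[0, t]) f (X s w)) - m) =
    (fun w => t^-1 * timeint (@path_at R E) t f w - m).
  by apply/funext => w; rewrite timeint_path_at.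
have -> : (fun w => f (X 0 w) - m) = (fun w => g (path_at 0 w)).
  by apply/funext => w; rewrite XE.
(* The initial value has law [mu], so the right-hand norm under [Q] is the norm of [g] in
   L^2(mu). *)
have [g0L g0E] := Lfun_law mY tlaw zt gL.
rewrite -!hnorm_class// avg_ae g0E -EFinM lee_fin.
rewrite (hnormZ (L2dot_inner_product Q)) ger0_norm ?invr_ge0 ?(ltW t_gt0)//.
have -> : Num.sqrt 2 * (t^-1 * kappa1 LM + (Num.sqrt t)^-1 * kappa2 Lm LM c1 c2) *
    hnorm (@L2dot _ _ R mu) (L2class mu g) = t^-1 *
    (Num.sqrt 2 * (kappa1 LM + Num.sqrt t * kappa2 Lm LM c1 c2) *
    hnorm (@L2dot _ _ R mu) (L2class mu g)).
  have st : Num.sqrt t != 0 by rewrite gt_eqF// sqrtr_gt0.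
  have tE : t = Num.sqrt t * Num.sqrt t by rewrite -expr2 sqr_sqrtr// ltW.
  have -> : (Num.sqrt t)^-1 = t^-1 * Num.sqrt t by rewrite {2}tE; field.
  ring.
by rewrite ler_wpM2l// invr_ge0 ltW.
Qed.
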